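(* Let $A$ be a Buchsbaum local ring with maximal ideal $\mathfrak{m}$, $d = \dim A \geq 1$ and $\mathrm{e}(A) > 1$. Let $Q$ be a parameter ideal in $A$ and put $I = Q : \mathfrak{m}$. Then $I^2 = QI$ if $\ell_A(I/Q) = \mathrm{r}(A)$.
   Context: A parameter ideal in $A$ is an ideal generated by a system of parameters. A Noetherian local ring $A$ with maximal ideal $\mathfrak{m}$ and $d = \dim A\geq 1$ is a Buchsbaum ring if the difference $\ell_A(A/Q) - \mathrm{e}^0_Q(A)$ is independent of the choice of a parameter ideal $Q$, where $\mathrm{e}^0_Q(A)$ is the multiplicity of $A$ with respect to $Q$; equivalently, every system of parameters $x_1,\dots,x_d$ satisfies $(x_1,\dots,x_{i-1}):x_i = (x_1,\dots,x_{i-1}):\mathfrak{m}$ for all $1\leq i\leq d$. $\mathrm{e}(A) = \mathrm{e}^0_{\mathfrak{m}}(A)$ is the multiplicity of $A$ with respect to $\mathfrak{m}$; $\ell_A$ denotes length; $Q:\mathfrak{m} = \{x\in A \mid x\mathfrak{m}\subseteq Q\}$. The Cohen-Macaulay type of $A$ is $\mathrm{r}(A) = \sup_Q \ell_A((Q:\mathfrak{m})/Q)$, where $Q$ runs over the parameter ideals in $A$; it is finite for Buchsbaum $A$ (it equals $\sum_{i=0}^{d-1}\binom{d}{i}\ell_A(\mathrm{H}^i_{\mathfrak{m}}(A)) + \mu_{\widehat{A}}(\mathrm{K}_{\widehat{A}})$, with $\mathrm{K}_{\widehat{A}}$ the canonical module of the completion $\widehat{A}$ and $\mu$ the minimal number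 of generators). *)

(* Defs.v *)
From mathcomp Require Import all_boot all_order all_algebra.
From mathcomp Require Import boolp classical_sets constructive_ereal.

Set Implicit Arguments.
Unset Strict Implicit.
Unset Printing Implicit Defensive.

Import Order.TTheory GRing.Theory Num.Theory.
Local Open Scope classical_set_scope.
Local Open Scope ring_scope.

(* Lengths, dimensions and types live in N with +oo adjoined, seen inside
   [\bar rat] so that they can be compared with the rational coefficients of
   Hilbert-Samuel polynomials.  The supremum of such a set always exists in
   [\bar rat] (see [enat_supremums_neq0]), so [supremum] never falls back on
   its default value for a nonempty set; the empty set has supremum 0. *)
Definition enat : set (\bar rat) :=
  [set x | x = +oo%E \/ exists n : nat, x = (n%:R)%:E].

Definition esup (S : set (\bar rat)) : \bar rat := supremum 0%E S.

Lemma enat_supremums_neq0 (S : set (\bar rat)) :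
  S `<=` enat -> S !=set0 -> supremums S !=set0 /\ enat (esup S).
Proof.
move=> Snat [s0 Ss0].
have H : supremums S `&` enat !=set0.
  case: (pselect (exists N : nat, ubound S (N%:R)%:E)) => [[N]|noN].
    elim: N => [|N IH] SN.
      exists 0%E; split; last by right; exists 0%N.
      split; first exact: SN.
      move=> y /(_ _ Ss0); apply: le_trans.
      case: (Snat _ Ss0) => [->|[n ->]]; rewrite ?leey //.
      by rewrite lee_fin ler0n.
    case: (pselect (ubound S (N%:R)%:E)) => [/IH //|SN'].
    exists (N.+1%:R)%:E; split; last by right; exists N.+1.
    split=> // y Sy.
    have [x Sx Nx] : exists2 x, S x & ~~ (x <= (N%:R)%:E)%E.
      apply: contrapT => Nex; apply: SN' => x Sx.
      by apply: contrapT => /negP xN; apply: Nex; exists x.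
    apply: le_trans (Sy _ Sx).
    case: (Snat _ Sx) Nx => [->|[n ->]]; rewrite ?leey //.
    by rewrite !lee_fin !ler_nat -ltnNge.
  exists +oo%E; split; last by left.
  split=> [x _|y Sy]; first exact: leey.
  case: y Sy => [q|//|] Sy; exfalso; last first.
    move: (Sy _ Ss0); rewrite leeNy_eq => /eqP s0E.
    by case: (Snat _ Ss0); rewrite s0E => // -[].
  apply: noN; exists (Num.Def.archi_bound `|q|) => x Sx.
  apply: le_trans (Sy _ Sx) _; rewrite lee_fin.
  by rewrite (le_trans (ler_norm q))// ltW// archi_boundP.
have [x [Sx xnat]] := H; split; first by exists x.
rewrite /esup /supremum; case: ifPn => [_|_]; first by right; exists 0%N.
by case: xgetP => [y -> Sy|/(_ x)//]; rewrite (is_subset1_supremums Sy Sx).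
Qed.

Section CommutativeAlgebra.
Variable A : comNzRingType.
Implicit Types (I J Q P m : set A) (d n : nat).

(* Not necessarily proper, unlike [idealr_closed]. *)
Definition is_ideal I : Prop :=
  I 0 /\ forall a x y, I x -> I y -> I (a * x + y).

Definition ideal_span (S : set A) : set A := smallest is_ideal S.

Definition ideal_mul I J : set A :=
  ideal_span [set z | exists x y, [/\ I x, J y & z = x * y]].

Definition ideal_exp I n : set A := iter n (ideal_mul I) setT.

Definition colon Q J : set A := [set x | forall y, J y -> Q (x * y)].

Definition radical I : set A := [set x | exists n, I (x ^+ n)].

Definition is_prime P : Prop :=
  [/\ is_ideal P, ~ P 1 & forall x y, P (x * y) -> P x \/ P y].

Definition is_maximal m : Prop :=
  [/\ is_ideal m, ~ m 1 &
      forall J, is_ideal J -> ~ J 1 -> m `<=` J -> J = m].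

Definition noetherian : Prop :=
  forall I, is_ideal I -> exists s : seq A, I = ideal_span [set` s].

Definition is_local m : Prop :=
  is_maximal m /\ forall m', is_maximal m' -> m' = m.

Definition strict_chain (C : set (set A)) n (L : nat -> set A) : Prop :=
  (forall i, (i <= n)%N -> C (L i)) /\
  (forall i, (i < n)%N -> L i `<` L i.+1).

Definition krull_dim : \bar rat :=
  esup [set x | exists n L, strict_chain is_prime n L /\ x = (n%:R)%:E].

(* The length of the A-module I/J, for ideals J `<=` I: the submodules of I/J
   correspond to the ideals between J and I. *)
Definition length I J : \bar rat :=
  esup [set x | exists n L,
    [/\ strict_chain is_ideal n L, L 0%N = J, L n = I & x = (n%:R)%:E]].

Definition is_sop m d (x : d.-tuple A) : Prop :=
  radical (ideal_span [set` x]) = m.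

Definition parameter_ideal m d Q : Prop :=
  exists2 x : d.-tuple A, is_sop m x & Q = ideal_span [set` x].

(* The polynomial that agrees with n |-> length (A/Q^(n+1)) for large n. *)
Definition hilbert_samuel_poly Q : {poly rat} :=
  xget 0 [set p : {poly rat} | exists N, forall n, (N <= n)%N ->
    length setT (ideal_exp Q n.+1) = (p.[n%:R])%:E].

(* e^0_Q(A) for d = dim A: the Hilbert-Samuel polynomial of an m-primary Q is
   e^0_Q(A) n^d / d! + lower order terms. *)
Definition multiplicity d Q : rat := d`!%:R * (hilbert_samuel_poly Q)`_d.

(* A is a Buchsbaum local ring with maximal ideal m and dimension d >= 1. *)
Definition buchsbaum m d : Prop :=
  [/\ noetherian, is_local m, krull_dim = (d%:R)%:E, (1 <= d)%N &
      forall Q Q', parameter_ideal m d Q -> parameter_ideal m d Q' ->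
        (length setT Q - (multiplicity d Q)%:E =
         length setT Q' - (multiplicity d Q')%:E)%E].

Definition cm_type m d : \bar rat :=
  esup [set length (colon Q m) Q | Q in parameter_ideal m d].

End CommutativeAlgebra.
Arguments krull_dim : clear implicits.
Arguments noetherian : clear implicits.

(* Main.v *)
Require Import Defs.
From mathcomp Require Import all_boot all_order all_algebra.
From mathcomp Require Import boolp classical_sets constructive_ereal.
From mathcomp Require Import ring lra zify.

(** Let y, N be a system of parameters, N generated by d - 1 elements, and let
    H = N : y.  The multiplicity of (x_1^k, ..., x_d^k) is k^d times that of
    (x_1, ..., x_d), because Q^(kn + d(k-1)) <= (x_1^k, ..., x_d^k)^n <= Q^(kn).
    Since l(A/Q) - e(Q) is constant and l(A/(y^n, N)) <= n l(A/(y, N)), this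
    homogeneity forces e(y^n, N) = n e(y, N).  Hence l(A/((y) + (N : y^n)))
    does not depend on n, so N : y^n = H for all n >= 1; then H does not depend
    on y either, and H = N : m because every w in m differs from a parameter
    modulo N by a power of y.

    If m I is not m Q, then Q = (wx, N) for some w, x in m with x m <= Q, so
    that m = (w) + (N : m) and e(A) <= e(w, N) <= 1.  Put T_i = Q + H_i, where
    H_i = N_i : m and N_i is generated by the parameters other than the i-th
    one, y_i.  Multiplication by y_i embeds A/T_i into A/(y_i^2, N_i), and
    comparing socles gives l((T_i : m)/Q) <= r(A); so T_i : m = I when
    l(I/Q) = r(A).  Finally let u, v be in I, u v = sum_i z_i y_i, and let w be
    in m.  As w u is in m Q, the element w u v lies in Q^2, and the relation
    sum_i (w z_i - q_i) y_i = 0 with q_i in Q shows w z_i in T_i.  Thus z_i is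
    in T_i : m = I. *)

Import Order.TTheory GRing.Theory Num.Theory.
Local Open Scope ring_scope.

Section BuchsbaumRings.
Set Implicit Arguments.
Unset Strict Implicit.
Unset Printing Implicit Defensive.
Local Open Scope classical_set_scope.

(** * Elementary operations on ideals *)

Section Ideals.

Variable A : comNzRingType.
Implicit Types (I J K L N Q : set A) (c g x y z : A) (s t : seq A).

Lemma ideal_0 I : is_ideal I -> I 0. Proof. by case. Qed.

Lemma ideal_add I x y : is_ideal I -> I x -> I y -> I (x + y).
Proof. by case=> _ h Ix Iy; rewrite -[x]mul1r; apply: h. Qed.

Lemma ideal_mull I a x : is_ideal I -> I x -> I (a * x).
Proof. by case=> h0 h Ix; rewrite -[_ * _]addr0; apply: h. Qed.

Lemma ideal_mulr I a x : is_ideal I -> I x -> I (x * a).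
Proof. by move=> iI Ix; rewrite mulrC; apply: ideal_mull. Qed.

Lemma ideal_opp I x : is_ideal I -> I x -> I (- x).
Proof. by move=> iI Ix; rewrite -mulN1r; apply: ideal_mull. Qed.

Lemma ideal_sub I x y : is_ideal I -> I x -> I y -> I (x - y).
Proof. by move=> iI Ix Iy; apply: ideal_add => //; apply: ideal_opp. Qed.

Lemma ideal_sum I (T : Type) (r : seq T) (P : pred T) (F : T -> A) :
  is_ideal I -> (forall i, P i -> I (F i)) -> I (\sum_(i <- r | P i) F i).
Proof.
by move=> iI IF; apply: (big_ind I); [exact: ideal_0|move=> *; exact: ideal_add|].
Qed.

Lemma ideal_setT : is_ideal [set: A]. Proof. by []. Qed.

Lemma ideal_zero : is_ideal [set (0 : A)].
Proof. by split=> // a x y -> ->; rewrite /= mulr0 addr0. Qed.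

Lemma ideal_cap I J : is_ideal I -> is_ideal J -> is_ideal (I `&` J).
Proof.
move=> [I0 hI] [J0 hJ]; split=> // a x y [Ix Jx] [Iy Jy].
by split; [apply: hI|apply: hJ].
Qed.

Definition addI I J : set A := [set z | exists x y, [/\ I x, J y & z = x + y]].

Definition mulI g I : set A := [set z | exists2 x, I x & z = g * x].

Definition colone J g : set A := [set x | J (x * g)].

Lemma ideal_addI I J : is_ideal I -> is_ideal J -> is_ideal (addI I J).
Proof.
move=> iI iJ; split; first by exists 0, 0; rewrite addr0; split=> //; exact: ideal_0.
move=> a _ _ [x [y [Ix Jy ->]]] [x' [y' [Ix' Jy' ->]]].
exists (a * x + x'), (a * y + y'); split; last by ring.
  by case: iI => _; apply.
by case: iJ => _; apply.
Qed.

Lemma ideal_mulI g I : is_ideal I -> is_ideal (mulI g I).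
Proof.
move=> iI; split; first by exists 0; rewrite ?mulr0//; exact: ideal_0.
move=> a _ _ [x Ix ->] [y Iy ->]; exists (a * x + y); last by ring.
by case: iI => _; apply.
Qed.

Lemma ideal_colone J g : is_ideal J -> is_ideal (colone J g).
Proof.
move=> iJ; split; first by rewrite /colone /= mul0r; exact: ideal_0.
move=> a x y /= Jx Jy; rewrite /colone /=.
have -> : (a * x + y) * g = a * (x * g) + y * g by ring.
by case: iJ => _; apply.
Qed.

Lemma ideal_colon J K : is_ideal J -> is_ideal (colon J K).
Proof.
move=> iJ; split; first by move=> y _; rewrite mul0r; exact: ideal_0.
move=> a x y /= Jx Jy z Kz.
have -> : (a * x + y) * z = a * (x * z) + y * z by ring.
by case: iJ => _; apply; [apply: Jx|apply: Jy].
Qed.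

Lemma subIaddl I J : is_ideal J -> I `<=` addI I J.
Proof. by move=> iJ x Ix; exists x, 0; rewrite addr0; split=> //; exact: ideal_0. Qed.

Lemma subIaddr I J : is_ideal I -> J `<=` addI I J.
Proof. by move=> iI x Jx; exists 0, x; rewrite add0r; split=> //; exact: ideal_0. Qed.

Lemma addI_sub I J K : is_ideal K -> I `<=` K -> J `<=` K -> addI I J `<=` K.
Proof. by move=> iK sI sJ _ [x [y [Ix Jy ->]]]; apply: ideal_add; auto. Qed.

Lemma addI_monor I J K : J `<=` K -> addI I J `<=` addI I K.
Proof. by move=> sJK _ [x [y [? ? ->]]]; exists x, y; split; auto. Qed.

Lemma addI_mono I I' J J' : I `<=` I' -> J `<=` J' -> addI I J `<=` addI I' J'.
Proof. by move=> s1 s2 _ [x [y [? ? ->]]]; exists x, y; split; auto. Qed.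

Lemma mulI_mono g I J : I `<=` J -> mulI g I `<=` mulI g J.
Proof. by move=> sIJ _ [x Ix ->]; exists x; auto. Qed.

(** * Finitely generated ideals *)

Definition prin g : set A := mulI g setT.

Definition gen s : set A := foldr (fun x I => addI (prin x) I) [set 0] s.

Lemma ideal_prin g : is_ideal (prin g).
Proof. exact: ideal_mulI. Qed.

Lemma prin_id g : prin g g. Proof. by exists 1; rewrite ?mulr1. Qed.

Lemma prin_sub g I : is_ideal I -> I g -> prin g `<=` I.
Proof. by move=> iI Ig _ [x _ ->]; exact: ideal_mulr. Qed.

Lemma ideal_gen s : is_ideal (gen s).
Proof.
by elim: s => [|x s IH]; [exact: ideal_zero|apply: ideal_addI => //; exact: ideal_prin].
Qed.

Lemma mem_gen s x : x \in s -> gen s x.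
Proof.
elim: s => //= y s IH; rewrite inE => /orP[/eqP ->|/IH h].
  by apply: subIaddl (ideal_gen s) _ _; exact: prin_id.
exact: subIaddr (ideal_prin y) _ _.
Qed.

Lemma gen_sub s I : is_ideal I -> (forall x, x \in s -> I x) -> gen s `<=` I.
Proof.
move=> iI; elim: s => [_ _ ->|x s IH h] /=; first exact: ideal_0.
apply: addI_sub => //; first by apply: prin_sub => //; apply: h; rewrite mem_head.
by apply: IH => y ys; apply: h; rewrite inE ys orbT.
Qed.

Lemma gen_subset s t : {subset s <= t} -> gen s `<=` gen t.
Proof. by move=> st; apply: gen_sub (ideal_gen t) _ => x /st /mem_gen. Qed.

Lemma gen_eqi s t : s =i t -> gen s = gen t.
Proof. by move=> st; apply/seteqP; split; apply: gen_subset => x; rewrite st. Qed.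

Lemma ideal_span_ideal (S : set A) : is_ideal (ideal_span S).
Proof.
split=> [I [iI _]|a x y hx hy I [iI SI]]; first exact: ideal_0.
by case: (iI) => _; apply; [apply: hx|apply: hy].
Qed.

Lemma sub_ideal_span (S : set A) : S `<=` ideal_span S.
Proof. by move=> x Sx I [_]; apply. Qed.

Lemma ideal_span_sub (S I : set A) : is_ideal I -> S `<=` I -> ideal_span S `<=` I.
Proof. by move=> iI SI x; apply. Qed.

Lemma ideal_spanE s : ideal_span [set` s] = gen s.
Proof.
apply/seteqP; split.
  by apply: ideal_span_sub (ideal_gen s) _ => x /= /mem_gen.
by apply: gen_sub (ideal_span_ideal _) _ => x xs; apply: sub_ideal_span.
Qed.

Lemma gen_lin s x : gen s x ->
  exists c : nat -> A, x = \sum_(i < size s) c i * s`_i.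
Proof.
elim: s x => [|y s IH] x /=; first by move=> ->; exists (fun=> 0); rewrite big_ord0.
move=> [_ [u [[b _ ->] /IH[c ->] ->]]].
exists (fun i => if i is i'.+1 then c i' else b).
by rewrite big_ord_recl /= mulrC; congr (_ + _).
Qed.

(** * Lengths *)

Lemma propersetP J K : J `<` K -> J `<=` K /\ exists2 z, K z & ~ J z.
Proof.
move=> [JK nKJ]; split=> //; apply: contrapT => h; apply: nKJ => z Kz.
by apply: contrapT => Jz; apply: h; exists z.
Qed.

Lemma properset_neq J I : J `<=` I -> J <> I -> J `<` I.
Proof. by move=> JI ne; split=> // IJ; apply: ne; apply/seteqP. Qed.

Lemma sub_properset_trans J K I : J `<=` K -> K `<` I -> J `<` I.
Proof.
move=> JK [KI nIK]; split; first exact: subset_trans KI.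
by move=> IJ; apply: nIK; exact: subset_trans JK.
Qed.

(** The last ideal need only lie below [I], which makes the predicate monotone when [J] shrinks or
    [I] grows ([chn_mono]), so lengths can be compared without adjusting endpoints. *)
Fixpoint chn (n : nat) J I : Prop :=
  if n is n'.+1 then exists K, [/\ is_ideal K, J `<` K, K `<=` I & chn n' K I]
  else True.

Definition fin J I := exists n, ~ chn n J I.

(* Junk value 0 when [I/J] has infinite length. *)
Definition len J I : nat := xget 0%N [set n | chn n J I /\ ~ chn n.+1 J I].

Lemma chn_mono n J J' I I' : J' `<=` J -> I `<=` I' -> chn n J I -> chn n J' I'.
Proof.
elim: n J J' => //= n IH J J' sJ sI [K [iK JK KI c]]; exists K; split=> //.
- exact: sub_properset_trans JK.
- exact: subset_trans KI sI.
- exact: IH sI c.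
Qed.

Lemma chnW n k J I : (k <= n)%N -> chn n J I -> chn k J I.
Proof.
elim: n k J => [|n IH] [|k] J //= kn [K [iK JK KI c]].
by exists K; split=> //; apply: IH c.
Qed.

Lemma chn_len J I : chn (len J I) J I.
Proof. by rewrite /len; case: xgetP => // n -> []. Qed.

Lemma finP J I : fin J I -> chn (len J I) J I /\ ~ chn (len J I).+1 J I.
Proof.
move=> fJI; rewrite /len; case: xgetP => [n -> //|no].
exfalso; case: fJI => n; apply; elim: n => // n IH.
by apply: contrapT => h; apply: (no n).
Qed.

Lemma chn_le n J I : fin J I -> chn n J I -> (n <= len J I)%N.
Proof.
by move=> /finP[_ h] c; rewrite leqNgt; apply/negP => ln; apply: h; exact: chnW c.
Qed.

Lemma len_bound k J I : (forall n, chn n J I -> (n <= k)%N) -> fin J I /\ (len J I <= k)%N.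
Proof.
move=> h; split; last by apply: h; exact: chn_len.
by exists k.+1 => /h; rewrite ltnn.
Qed.

Lemma fin_sub J J' I I' : J `<=` J' -> I' `<=` I -> fin J I -> fin J' I'.
Proof. by move=> sJ sI [n h]; exists n => c; apply: h; exact: chn_mono c. Qed.

Lemma len_mono J J' I I' : fin J I -> J `<=` J' -> I' `<=` I ->
  (len J' I' <= len J I)%N.
Proof. by move=> f sJ sI; apply: chn_le => //; apply: chn_mono (chn_len _ _). Qed.

Lemma chn_cat a b J K I : J `<=` K -> K `<=` I -> is_ideal I ->
  chn a J K -> chn b K I -> chn (a + b) J I.
Proof.
move=> + KI iI; elim: a J => [|a IH] J /= JK.
  by move=> _; apply: chn_mono.
move=> [L [iL JL LK c]] cb; exists L; split=> //; first exact: subset_trans KI.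
exact: IH.
Qed.

(* The modular law: a strict inclusion of ideals stays strict after
   intersecting with [K] or after adding [K]. *)
Lemma chn_split n J K I : is_ideal J -> is_ideal K -> J `<=` I -> K `<=` I -> is_ideal I ->
  chn n J I -> exists a b, [/\ (n <= a + b)%N, chn a (J `&` K) K & chn b (addI J K) I].
Proof.
move=> + iK + KI iI; elim: n J => [|n IH] J iJ JI; first by exists 0%N, 0%N.
move=> /= [L [iL /propersetP[JL [l Ll nJl]] LI /(IH _ iL LI)[a [b [nab ca cb]]]]].
case: (pselect ((L `&` K) `<=` J)) => [sLK|nLK].
  exists a, b.+1; split; first by rewrite addnS ltnS.
    by apply: chn_mono ca => // x [Jx Kx]; split; auto.
  exists (addI L K); split=> //; first exact: ideal_addI.
    split; first exact: addI_mono.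
    move=> /(_ l); case; first by exact: subIaddl.
    move=> x [y [Jx Ky lE]]; apply: nJl; rewrite lE; apply: ideal_add => //.
    apply: sLK; split=> //; have -> : y = l - x by rewrite lE; ring.
    by apply: ideal_sub; auto.
  exact: addI_sub.
exists a.+1, b; split; rewrite ?addSn ?ltnS//; last first.
  by apply: chn_mono cb => //; apply: addI_mono.
exists (L `&` K); split; [exact: ideal_cap| |by move=> ? []|by []].
split; first by move=> x [Jx Kx]; split; auto.
by move=> h; apply: nLK => x /h[].
Qed.

(** Concatenating chains gives one inequality, and splitting a longest chain along [K] with
    [chn_split] gives the other. *)
Lemma len_add J K I : is_ideal J -> is_ideal K -> is_ideal I -> J `<=` K -> K `<=` I ->
  fin J I -> len J I = (len J K + len K I)%N.
Proof.
move=> iJ iK iI JK KI fJI; apply/eqP; rewrite eqn_leq; apply/andP; split; last first.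
  by apply: chn_le => //; apply: chn_cat JK KI _ _ _ => //; exact: chn_len.
have [a [b [le ca cb]]] := chn_split iJ iK (subset_trans JK KI) KI iI (chn_len J I).
apply: leq_trans le _; apply: leq_add; apply: chn_le.
- exact: fin_sub fJI.
- by apply: chn_mono ca => // x Jx; split; auto.
- exact: fin_sub fJI.
- by apply: chn_mono cb => //; exact: subIaddr.
Qed.

Lemma fin_trans J K I : is_ideal J -> is_ideal K -> is_ideal I -> J `<=` K -> K `<=` I ->
  fin J K -> fin K I -> fin J I.
Proof.
move=> iJ iK iI JK KI fJK fKI; exists (len J K + len K I).+1 => c.
have [a [b [le ca cb]]] := chn_split iJ iK (subset_trans JK KI) KI iI c.
have : (a + b <= len J K + len K I)%N.
  apply: leq_add; apply: chn_le => //.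
  - by apply: chn_mono ca => // x Jx; split; auto.
  - by apply: chn_mono cb => //; exact: subIaddr.
by move=> /(leq_trans le); rewrite ltnn.
Qed.

Lemma len_eq0 J I : is_ideal I -> J `<=` I -> fin J I -> len J I = 0%N -> J = I.
Proof.
move=> iI JI fJI l0; apply: contrapT => ne.
have : (1 <= len J I)%N by apply: chn_le => //; exists I; split=> //; exact: properset_neq.
by rewrite l0.
Qed.

Lemma chn_map (f : set A -> set A) n J I J' I' :
  (forall K, is_ideal K -> J `<=` K -> K `<=` I -> is_ideal (f K) /\ f K `<=` I') ->
  (forall K L, is_ideal K -> is_ideal L -> J `<=` K -> K `<` L -> L `<=` I -> f K `<` f L) ->
  is_ideal J -> J' `<=` f J -> chn n J I -> chn n J' I'.
Proof.
move=> hf hlt; elim: n J J' hf hlt => //= n IH J J' hf hlt iJ JJ' [K [iK JK KI c]].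
have JK' : J `<=` K by case: JK.
exists (f K); have [ifK fKI] := hf K iK JK' KI; split=> //.
  by apply: sub_properset_trans JJ' _; apply: hlt.
apply: (IH K) => //.
- by move=> L iL KL LI; apply: hf => //; exact: subset_trans KL.
- by move=> L M iL iM KL LM MI; apply: hlt => //; exact: subset_trans KL.
Qed.

(** Multiplication by g induces an isomorphism from K/((J : g) ∩ K) onto (J + gK)/J. Chains are
    carried across by the strictly increasing maps L -> (L : g) ∩ K and L -> J + gL. *)
Lemma chn_mulI g n J K : is_ideal J -> is_ideal K ->
  chn n J (addI J (mulI g K)) <-> chn n (colone J g `&` K) K.
Proof.
move=> iJ iK; have iJg := ideal_colone g iJ; split.
  apply: (@chn_map (fun L => colone L g `&` K)) => //.
    by move=> L iL _ _; split; [apply: ideal_cap => //; exact: ideal_colone|move=> ? []].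
  move=> L M iL iM JL /propersetP[LM [z Mz nLz]] MI; split.
    by move=> x [Lx Kx]; split=> //; exact: LM.
  move: (MI _ Mz) => [j [_ [Jj [k Kk ->] zE]]] h.
  apply: nLz; rewrite zE; apply: ideal_add => //; first exact: JL.
  rewrite mulrC; suff : (colone L g `&` K) k by case.
  apply: h; split=> //; rewrite /colone /= mulrC.
  have -> : g * k = z - j by rewrite zE; ring.
  by apply: ideal_sub => //; apply: LM; apply: JL.
apply: (@chn_map (fun L => addI J (mulI g L))) => //.
- move=> L iL _ LK; split; first by apply: ideal_addI => //; exact: ideal_mulI.
  by apply: addI_monor; exact: mulI_mono.
- move=> L M iL iM JL /propersetP[LM [z Mz nLz]] MI; split.
    by apply: addI_monor; exact: mulI_mono.
  move=> h; have : addI J (mulI g L) (g * z).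
    by apply: h; apply: subIaddr => //; exists z.
  move=> [j [_ [Jj [l Ll ->] zE]]]; apply: nLz.
  have -> : z = (z - l) + l by ring.
  apply: ideal_add => //; apply: JL; split; last by apply: ideal_sub => //; apply: MI => //; apply: LM.
  rewrite /colone /=; suff -> : (z - l) * g = j by [].
  by rewrite mulrBl mulrC zE; ring.
- exact: ideal_cap.
- by apply: subIaddl; apply: ideal_mulI; exact: ideal_cap.
Qed.

Lemma fin_mulI g J K : is_ideal J -> is_ideal K ->
  fin J (addI J (mulI g K)) <-> fin (colone J g `&` K) K.
Proof. by move=> iJ iK; split=> -[n h]; exists n => /(@chn_mulI g _ _ _ iJ iK). Qed.

Lemma len_mulI g J K : is_ideal J -> is_ideal K ->
  len J (addI J (mulI g K)) = len (colone J g `&` K) K.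
Proof.
move=> iJ iK; rewrite /len; congr xget; apply/funext => n.
by congr (_ /\ ~ _); apply/propext; exact: chn_mulI.
Qed.

Lemma mulI1 K : mulI 1 K = K.
Proof.
by apply/seteqP; split=> [_ [x Kx ->]|x Kx]; [rewrite mul1r|exists x; rewrite ?mul1r].
Qed.

Lemma colone1 J : colone J 1 = J.
Proof. by apply/seteqP; split=> x; rewrite /colone /= mulr1. Qed.

Lemma len_addI J K : is_ideal J -> is_ideal K -> len J (addI J K) = len (J `&` K) K.
Proof. by move=> iJ iK; have := len_mulI 1 iJ iK; rewrite mulI1 colone1. Qed.

Lemma fin_addI J K : is_ideal J -> is_ideal K ->
  fin J (addI J K) <-> fin (J `&` K) K.
Proof. by move=> iJ iK; have := fin_mulI 1 iJ iK; rewrite mulI1 colone1. Qed.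

(* [chn] allows the last ideal of the chain to be smaller than [I]; [ech], like
   [strict_chain] in [length], does not. *)
Fixpoint ech (n : nat) J I : Prop :=
  if n is n'.+1 then exists K, [/\ is_ideal K, J `<` K, K `<=` I & ech n' K I]
  else J = I.

Lemma ech_chn n J I : ech n J I -> chn n J I.
Proof. by elim: n J => //= n IH J [K [? ? ? /IH]]; exists K. Qed.

Lemma chn_ech n J I : is_ideal I -> J `<=` I -> chn n J I ->
  exists2 k, (n <= k)%N & ech k J I.
Proof.
move=> iI; elim: n J => [|n IH] J JI /=.
  case: (pselect (J = I)) => [->|ne]; first by exists 0%N.
  by exists 1%N => //; exists I; split=> //; exact: properset_neq.
by move=> [K [iK JK KI /(IH _ KI)[k nk c]]]; exists k.+1 => //; exists K.
Qed.

Lemma echP n J I : is_ideal I -> is_ideal J -> J `<=` I ->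
  ech n J I <-> exists L : nat -> set A, [/\ strict_chain (@is_ideal A) n L, L 0%N = J & L n = I].
Proof.
move=> iI iJ JI; split.
  elim: n J iJ JI => [|n IH] J iJ JI /=.
    by move=> ->; exists (fun=> I); split=> //; split.
  move=> [K [iK JK KI /(IH _ iK KI)[L [[iL sL] L0 Ln]]]].
  exists (fun i => if i is j.+1 then L j else J); split=> //; split.
    by case=> // i; exact: iL.
  by case=> [_|i]; [rewrite L0|exact: sL].
elim: n J iJ JI => [|n IH] J iJ JI [L [[iL sL] L0 Ln]]; first by rewrite /= -L0 -Ln.
have mL i : (i <= n)%N -> L i.+1 `<=` I.
  move=> ni; have aux k : (k <= n - i)%N -> L i.+1 `<=` L (i.+1 + k)%N.
    elim: k => [|k IHk] le; first by rewrite addn0.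
    apply: subset_trans (IHk (ltnW le)) _; rewrite addnS.
    by have /sL[] : (i.+1 + k < n.+1)%N by lia.
  by rewrite -Ln; have := aux _ (leqnn _); rewrite addSn subnKC.
exists (L 1%N); split.
- exact: iL.
- by rewrite -L0; apply: sL.
- exact: mL.
- apply: IH; [exact: iL|exact: mL|].
  by exists (fun i => L i.+1); split=> //; split=> i ?; [apply: iL|apply: sL].
Qed.

Lemma esupE (S : set (\bar rat)) (x : \bar rat) : S x -> ubound S x -> esup S = x.
Proof.
move=> Sx ux; rewrite /esup /supremum; case: ifPn => [/eqP S0|_]; first by rewrite S0 in Sx.
have sx : supremums S x by split=> // y; apply.
case: xgetP => [y -> sy|/(_ x)//].
exact: is_subset1_supremums sy sx.
Qed.

(** A chain of maximal length already ends at [I], because otherwise [I] could be appended to it; so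
    [chn] and [strict_chain] give the same maximum. *)
Lemma lengthE J I : is_ideal I -> is_ideal J -> J `<=` I -> fin J I ->
  length I J = ((len J I)%:R)%:E.
Proof.
move=> iI iJ JI fJI; apply: esupE.
  have [k nk c] := chn_ech iI JI (chn_len J I).
  have kE : k = len J I by apply/eqP; rewrite eqn_leq nk andbT; apply: chn_le => //; exact: ech_chn.
  have /(echP _ iI iJ JI)[L [h1 h2 h3]] := c.
  by exists k, L; rewrite h2 h3 -kE.
move=> _ [n [L [h1 h2 h3 ->]]]; rewrite lee_fin ler_nat; apply: chn_le => //.
by apply: ech_chn; apply/echP => //; exists L.
Qed.

End Ideals.

(** * Hilbert-Samuel polynomials *)

Section EventuallyPolynomial.

(** The bound is on [size]: the degree is below [k], and [k = 0] means eventually zero. *)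
Definition evpoly (k : nat) (h : nat -> nat) : Prop :=
  exists2 p : {poly rat}, (size p <= k)%N &
    exists N, forall n, (N <= n)%N -> (h n)%:R = p.[n%:R].

Lemma antidifference (k : nat) (q : {poly rat}) : (size q <= k)%N ->
  exists2 P : {poly rat}, (size P <= k.+1)%N & forall r, P.[r + 1] - P.[r] = q.[r].
Proof.
elim: k q => [|k IH] q.
  by rewrite leqn0 size_poly_eq0 => /eqP ->; exists 0 => [|r]; rewrite ?size_poly0// !horner0 subr0.
(* [Y] is X + 1, so [D] = (X + 1)^(k+1) - X^(k+1) has degree k and leading coefficient k + 1.
   Subtracting a multiple of [D] from [q] lowers the degree. *)
move=> sq; pose Y : {poly rat} := 'X - (-1)%:P.
pose D : {poly rat} := \sum_(i < k.+1) Y ^+ (k - i) * 'X^i.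
have DE : Y ^+ k.+1 - 'X^(k.+1) = D.
  have YX : Y - 'X = 1 by rewrite /Y polyCN opprK addrAC subrr add0r.
  by rewrite subrXX YX mul1r.
have sY n : size (Y ^+ n) = n.+1 by rewrite size_exp_XsubC.
have mY n : Y ^+ n \is monic by rewrite monic_exp// monicXsubC.
have sD : (size D <= k.+1)%N.
  rewrite (leq_trans (size_sum _ _ _))//; apply/bigmax_leqP => i _.
  rewrite size_mulXn ?monic_neq0// sY; have := ltn_ord i; lia.
have Dk : D`_k = k.+1%:R.
  rewrite coef_sum (eq_bigr (fun=> 1)) ?sumr_const ?card_ord// => i _.
  have ik := ltn_ord i; rewrite coefMXn ltnNge -ltnS ik /=.
  by have /monicP := mY (k - i)%N; rewrite /lead_coef sY.
pose c := q`_k / k.+1%:R.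
have [|P sP PE] := IH (q - c *: D).
  apply/leq_sizeP => j; rewrite leq_eqVlt => /orP[/eqP <-|kj].
    by rewrite coefB coefZ Dk divfK ?subrr// pnatr_eq0.
  rewrite coefB coefZ (leq_sizeP _ _ sq)// (leq_sizeP _ _ sD)//; ring.
exists (P + c *: 'X^(k.+1)).
  rewrite (leq_trans (size_polyD _ _))// geq_max (leq_trans sP)//=.
  by rewrite (leq_trans (size_scale_leq _ _))// size_polyXn.
move=> r.
have Dr : D.[r] = (r + 1) ^+ k.+1 - r ^+ k.+1.
  by rewrite -DE hornerD hornerN hornerXn horner_exp hornerXsubC opprK.
have := PE r; rewrite !(hornerD, hornerN, hornerZ, hornerXn) Dr => h.
have -> : q.[r] = P.[r + 1] - P.[r] + c * ((r + 1) ^+ k.+1 - r ^+ k.+1).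
  by rewrite h; ring.
ring.
Qed.

Lemma evpoly_diff (k : nat) (h q : nat -> nat) : evpoly k q ->
  (forall n, h n.+1 = h n + q n)%N -> evpoly k.+1 h.
Proof.
move=> [p sp [N pE]] hE; have [P sP PE] := antidifference sp.
pose c := (h N)%:R - P.[N%:R].
exists (P + c%:P).
  by rewrite (leq_trans (size_polyD _ _))// geq_max sP/= (leq_trans (size_polyC_leq1 _)).
exists N => n Nn; rewrite -(subnKC Nn); elim: (n - N)%N => [|j IH].
  by rewrite addn0 hornerD hornerC /c addrC subrK.
rewrite addnS hE natrD IH pE ?leq_addr// -PE !(hornerD, hornerC) -[(N + j).+1%:R]natr1; ring.
Qed.

Lemma evpoly_shift (k : nat) (q : nat -> nat) : evpoly k q -> evpoly k (fun n => q n.+1).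
Proof.
move=> [p sp [N pE]]; exists (p \Po ('X - (-1)%:P)).
  by rewrite size_comp_poly2 ?size_XsubC.
exists N => n Nn; rewrite horner_comp pE ?(leqW Nn)// !hornerE opprK natr1//.
Qed.

Lemma evpoly_step (k k' : nat) (h a b : nat -> nat) : (k <= k')%N ->
  (forall n, h n.+1 = a n + b n.+1)%N -> evpoly k' a -> evpoly k b -> evpoly k' h.
Proof.
move=> kk hE [p sp [N pE]] [q sq [M qE]]; exists (p \Po ('X - 1%:P) + q).
  rewrite (leq_trans (size_polyD _ _))// geq_max size_comp_poly2 ?size_XsubC// sp/=.
  exact: leq_trans sq kk.
exists (N + M).+1 => -[//|n] nM; rewrite hE natrD hornerD horner_comp qE; last by lia.
rewrite pE; last by lia.
by rewrite !hornerE -natr1 addrK.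
Qed.

End EventuallyPolynomial.

(** * Chain condition and powers of a finitely generated ideal *)

Section Rees.

Variable A : comNzRingType.
Implicit Types (I J L : set A) (c g x y z p : A) (s : seq A).

Lemma noetherian_acc (L : nat -> set A) : noetherian A ->
  (forall i, is_ideal (L i)) -> (forall i, L i `<=` L i.+1) ->
  exists T, forall i, (T <= i)%N -> L i = L T.
Proof.
move=> noe iL sL.
have mL i j : (i <= j)%N -> L i `<=` L j.
  move=> ij; rewrite -(subnKC ij); elim: (j - i)%N => [|k IH]; first by rewrite addn0.
  by rewrite addnS; apply: subset_trans IH _; exact: sL.
pose U : set A := [set x | exists i, L i x].
have iU : is_ideal U.
  split; first by exists 0%N; exact: ideal_0.
  move=> a x y [i Lx] [j Ly]; exists (maxn i j); case: (iL (maxn i j)) => _; apply.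
    exact: (mL _ _ (leq_maxl i j)).
  exact: (mL _ _ (leq_maxr i j)).
have [s UE] := noe U iU; rewrite ideal_spanE in UE.
have [T hT] : exists T, forall x, x \in s -> L T x.
  have : forall x, x \in s -> U x by move=> x /mem_gen; rewrite -UE.
  elim: {UE}s => [|y s IH] h; first by exists 0%N.
  have [|T hT] := IH; first by move=> x xs; apply: h; rewrite inE xs orbT.
  have [i Li] := h y (mem_head _ _); exists (maxn i T) => x.
  rewrite inE => /orP[/eqP ->|/hT]; first exact: (mL _ _ (leq_maxl i T)).
  exact: (mL _ _ (leq_maxr i T)).
exists T => i Ti; apply/seteqP; split; last exact: mL.
move=> x Lx; apply: (gen_sub (iL T) hT); rewrite -UE; by exists i.
Qed.

(** The n-th power of [gen s] (see [pw_exp]), built by (x, s)^n = (s)^n + x (x, s)^(n-1) so that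
    proofs can induct on the number of generators. *)
Fixpoint pw s : nat -> set A :=
  match s with
  | [::] => fun n => if n is 0%N then setT else [set 0]
  | x :: s' => fix aux n :=
      if n is n'.+1 then addI (pw s' n'.+1) (mulI x (aux n')) else setT
  end.

(** The component of degree n - 1 of the Rees algebra, which is zero in degree -1. *)
Definition pwpred s n : set A := if n is n'.+1 then pw s n' else [set 0].

Lemma pwS x s n : pw (x :: s) n.+1 = addI (pw s n.+1) (mulI x (pw (x :: s) n)).
Proof. by []. Qed.

Lemma pw0 s : pw s 0 = setT. Proof. by case: s. Qed.

Lemma ideal_pw s n : is_ideal (pw s n).
Proof.
elim: s n => [|x s IHs] [|n]; rewrite ?pw0//; first exact: ideal_zero.
elim: n => [|n IHn]; rewrite pwS; apply: ideal_addI => //; exact: ideal_mulI.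
Qed.

Lemma ideal_pwpred s n : is_ideal (pwpred s n).
Proof. by case: n => [|n]; [exact: ideal_zero|exact: ideal_pw]. Qed.

Lemma pw_cons x s n z : pw (x :: s) n z ->
  exists c p, [/\ pw s n c, pwpred (x :: s) n p & z = c + x * p].
Proof.
case: n => [|n].
  by exists z, 0; rewrite pw0 mulr0 addr0.
by rewrite pwS => -[c [_ [sc [p xp ->] ->]]]; exists c, p.
Qed.

Lemma pw_consW x s n : pw s n `<=` pw (x :: s) n.
Proof.
case: n => [|n]; rewrite ?pw0//.
by apply: subIaddl; apply: ideal_mulI; exact: (ideal_pw (x :: s)).
Qed.

Lemma pw_mem s n y z : y \in s -> pw s n z -> pw s n.+1 (y * z).
Proof.
elim: s n y z => //= x s IHs n y z; rewrite inE => /orP[/eqP ->|ys].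
  by move=> xz; apply: subIaddr; [exact: ideal_pw|exists z].
elim: n z => [|n IHn] z.
  by move=> _; apply: subIaddl; [exact: (ideal_mulI _ (ideal_pw (x :: s) 0))|apply: IHs; rewrite // pw0].
move=> [c [_ [sc [p xp ->] ->]]].
exists (y * c), (x * (y * p)); split; [exact: IHs| |by ring].
by exists (y * p) => //; exact: IHn.
Qed.

Lemma pw_gen s n y z : gen s y -> pw s n z -> pw s n.+1 (y * z).
Proof.
move=> sy nz; suff : gen s `<=` colone (pw s n.+1) z by apply.
apply: gen_sub => [|x xs]; first exact: ideal_colone (ideal_pw _ _).
exact: pw_mem.
Qed.

Lemma pwS_sub s n : pw s n.+1 `<=` pw s n.
Proof.
elim: s n => [|x s IHs] n; first by case: n => [|n]; rewrite ?pw0//=; apply.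
elim: n => [|n IHn]; first by rewrite pw0.
by rewrite !pwS; apply: addI_mono; [exact: IHs|exact: mulI_mono].
Qed.

Lemma pw1 s : pw s 1 = gen s.
Proof. by elim: s => //= x s ->; apply/seteqP; split=> z [u [v [? ? ->]]]; exists v, u; rewrite addrC. Qed.

Lemma pw_exp s n : ideal_exp (gen s) n = pw s n.
Proof.
elim: n => [|n IH]; first by rewrite pw0.
rewrite /ideal_exp iterS -/(ideal_exp _ _) IH; apply/seteqP; split.
  by apply: ideal_span_sub (ideal_pw _ _) _ => _ [x [y [sx ny ->]]]; exact: pw_gen.
elim: s n {IH} => [|x s IHs] n.
  by move=> z /= ->; apply: ideal_0; exact: ideal_span_ideal.
have iS := ideal_span_ideal [set z | exists u v, [/\ gen (x :: s) u, pw (x :: s) n v & z = u * v]].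
rewrite pwS; apply: addI_sub => //.
  apply: subset_trans (IHs n) _; apply: ideal_span_sub => // _ [u [v [su sv ->]]].
  apply: sub_ideal_span; exists u, v; split=> //; last exact: pw_consW.
  by apply: subIaddr => //; exact: ideal_prin.
move=> _ [p xp ->]; apply: sub_ideal_span; exists x, p; split=> //.
by apply: mem_gen; rewrite mem_head.
Qed.

(** * Graded ideals of the Rees algebra *)

(** These are the components of a homogeneous ideal of the Rees algebra of [gen s], whose component
    of degree n is [pw s n]. *)
Definition graded s (K : nat -> set A) : Prop :=
  [/\ forall n, is_ideal (K n), forall n, K n `<=` pw s n &
      forall y n z, y \in s -> K n z -> K n.+1 (y * z)].

(* Coefficients of [x ^+ j] in the elements of [K (n + j)] whose terms of lower
   degree in [x] vanish: the lowest-term analogue of the leading coefficient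
   ideals in Hilbert's basis theorem. *)
Definition lowc x s (K : nat -> set A) j n : set A :=
  [set c | pw s n c /\ exists2 p, pwpred (x :: s) n p &
                        K (n + j)%N (x ^+ j * c - x ^+ j.+1 * p)].

Lemma graded_lowc x s K j : graded (x :: s) K -> graded s (lowc x s K j).
Proof.
move=> [iK sK mK]; split=> [n|n c []//|y n c ys [sc [p xp Kp]]].
  split.
    split; first exact: ideal_0 (ideal_pw _ _).
    exists 0; first exact: ideal_0 (ideal_pwpred _ _).
    by rewrite !mulr0 subr0; exact: ideal_0.
  move=> a c c' [sc [p xp Kp]] [sc' [p' xp' Kp']]; split.
    by case: (ideal_pw s n) => _; apply.
  exists (a * p + p'); first by case: (ideal_pwpred (x :: s) n) => _; apply.
  have -> : x ^+ j * (a * c + c') - x ^+ j.+1 * (a * p + p') =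
    a * (x ^+ j * c - x ^+ j.+1 * p) + (x ^+ j * c' - x ^+ j.+1 * p') by ring.
  by case: (iK (n + j)%N) => _; apply.
split; first exact: pw_mem.
exists (y * p).
  case: n xp {sc Kp} => [|n] xp; first exact: I.
  by apply: (@pw_mem (x :: s)) => //; rewrite inE ys orbT.
have -> : x ^+ j * (y * c) - x ^+ j.+1 * (y * p) = y * (x ^+ j * c - x ^+ j.+1 * p) by ring.
by rewrite addSn; apply: mK; rewrite // inE ys orbT.
Qed.

Lemma lowc_mono x s K j n : graded (x :: s) K -> lowc x s K j n `<=` lowc x s K j.+1 n.
Proof.
move=> [iK sK mK] c [sc [p xp Kp]]; split=> //; exists p => //.
have -> : x ^+ j.+1 * c - x ^+ j.+2 * p = x * (x ^+ j * c - x ^+ j.+1 * p) by rewrite !exprS; ring.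
by rewrite addnS; apply: mK; rewrite // mem_head.
Qed.

Lemma lowc_sub x s K K' j n : (forall n, K n `<=` K' n) -> lowc x s K j n `<=` lowc x s K' j n.
Proof. by move=> sK c [sc [p xp Kp]]; split=> //; exists p => //; exact: sK. Qed.

(** The lowest term in x of an element of K' is also that of an element of K. Subtracting the latter
    leaves a multiple of a higher power of x. The claim is therefore proved for elements x^j p with
    p of degree n: each subtraction raises j and lowers n, while n + j stays fixed. *)
Lemma lowc_inj x s K K' : graded (x :: s) K -> graded (x :: s) K' ->
  (forall n, K n `<=` K' n) -> (forall j n, lowc x s K' j n `<=` lowc x s K j n) ->
  forall n, K' n `<=` K n.
Proof.
move=> [iK sK mK] [iK' sK' mK'] KK' lK.
suff H n j p : pw (x :: s) n p -> K' (n + j)%N (x ^+ j * p) -> K (n + j)%N (x ^+ j * p).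
  by move=> n z K'z; have := H n 0%N z; rewrite addn0 expr0 mul1r; apply=> //; exact: sK'.
elim: n j p => [|n IH] j p xp K'p; have [c [q [sc xq pE]]] := pw_cons xp.
  have : lowc x s K' j 0 c.
    split=> //; exists (- q); first exact: ideal_opp (ideal_pwpred _ _) xq.
    suff -> : x ^+ j * c - x ^+ j.+1 * - q = x ^+ j * p by [].
    by rewrite pE exprS; ring.
  move=> /lK[_ [r /= rE]]; rewrite rE mulr0 subr0; move: pE; rewrite (xq : q = 0).
  by rewrite mulr0 addr0 => ->.
have : lowc x s K' j n.+1 c.
  split=> //; exists (- q); first exact: ideal_opp (ideal_pwpred _ _) xq.
  suff -> : x ^+ j * c - x ^+ j.+1 * - q = x ^+ j * p by [].
  by rewrite pE exprS; ring.
move=> /lK[_ [r /= xr Kr]].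
have xE : x ^+ j * p = (x ^+ j * c - x ^+ j.+1 * r) + x ^+ j.+1 * (q + r).
  by rewrite pE exprS; ring.
rewrite xE; apply: ideal_add => //.
rewrite addSnnS; apply: IH; first exact: ideal_add (ideal_pw _ _) xq xr.
have -> : x ^+ j.+1 * (q + r) = x ^+ j * p - (x ^+ j * c - x ^+ j.+1 * r) by rewrite xE; ring.
by rewrite -addSnnS; apply: ideal_sub => //; exact: KK'.
Qed.

(** Hilbert's basis theorem for the Rees algebra, by induction on the generators. The diagonal
    [lowc x s (K t) t] is constant from some [T0] on, which controls all j >= T0. Each of the
    finitely many j < T0 stabilises separately, and [lowc_inj] concludes. *)
Lemma graded_acc s (K : nat -> nat -> set A) : noetherian A ->
  (forall t, graded s (K t)) -> (forall t n, K t n `<=` K t.+1 n) ->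
  exists T, forall t n, (T <= t)%N -> K t n = K T n.
Proof.
move=> noe; elim: s K => [|x s IHs] K gK sK.
  have [|t|T hT] := @noetherian_acc (fun t => K t 0%N) noe.
  - by move=> t; case: (gK t).
  - exact: sK.
  exists T => t [|n] Tt; first exact: hT.
  have K0 r : K r n.+1 = [set 0].
    apply/seteqP; split; first by case: (gK r) => _ h _; exact: h.
    by move=> _ ->; apply: ideal_0; case: (gK r).
  by rewrite !K0.
have mK t u n : (t <= u)%N -> K t n `<=` K u n.
  move=> tu; rewrite -(subnKC tu); elim: (u - t)%N => [|k IH]; first by rewrite addn0.
  by rewrite addnS; apply: subset_trans IH _; exact: sK.
have ml t i j n : (i <= j)%N -> lowc x s (K t) i n `<=` lowc x s (K t) j n.
  move=> ij; rewrite -(subnKC ij); elim: (j - i)%N => [|k IH]; first by rewrite addn0.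
  by rewrite addnS; apply: subset_trans IH _; exact: lowc_mono.
have [||T0 hT0] := IHs (fun t => lowc x s (K t) t).
- by move=> t; exact: graded_lowc.
- move=> t n; apply: subset_trans (ml t t t.+1 n _) _ => //.
  by apply: lowc_sub => m; exact: sK.
have [T TT0 hT] : exists2 T, (T0 <= T)%N & forall j t n, (j < T0)%N -> (T <= t)%N ->
    lowc x s (K t) j n = lowc x s (K T) j n.
  elim: {hT0}T0 => [|J [T JT hT]]; first by exists 0%N.
  have [||T1 hT1] := IHs (fun t => lowc x s (K t) J).
  - by move=> t; exact: graded_lowc.
  - by move=> t n; apply: lowc_sub => m; exact: sK.
  exists (maxn J.+1 (maxn T T1)); first exact: leq_maxl.
  move=> j t n; rewrite ltnS leq_eqVlt !geq_max => /orP[/eqP ->|jJ] /and3P[_ Tt T1t].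
    by rewrite hT1// [RHS]hT1// !leq_max leqnn !orbT.
  by rewrite hT// [RHS]hT// !leq_max leqnn !orbT.
exists T => t n Tt; apply/seteqP; split; last exact: mK.
move: n; apply: (@lowc_inj x s) => // [n|j n]; first exact: mK.
case: (ltnP j T0) => jT0; first by rewrite hT.
apply: (@subset_trans _ (lowc x s (K (maxn t j)) (maxn t j) n)).
  apply: subset_trans (ml _ _ _ _ (leq_maxr t j)) _.
  by apply: lowc_sub => m; apply: mK; exact: leq_maxl.
rewrite (hT0 (maxn t j) n); last by rewrite leq_max (leq_trans TT0).
apply: subset_trans (ml _ _ _ _ jT0) _.
by apply: lowc_sub => m; exact: mK.
Qed.

(** The colon ideal of [K] by x, taken as an element of degree 1 of the Rees algebra. *)
Definition shiftc x s (K : nat -> set A) n : set A := colone (K n.+1) x `&` pw (x :: s) n.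

Lemma graded_shiftc x s K : graded (x :: s) K -> graded (x :: s) (shiftc x s K).
Proof.
move=> [iK sK mK]; split=> [n|n z []//|y n z ys [Kz xz]].
  by apply: ideal_cap; [exact: ideal_colone|exact: ideal_pw].
split; last exact: pw_mem.
by rewrite /colone /= -mulrA; exact: mK.
Qed.

Lemma sub_shiftc x s K n : graded (x :: s) K -> K n `<=` shiftc x s K n.
Proof.
move=> [iK sK mK] z Kz; split; last exact: sK.
by rewrite /colone /= mulrC; apply: mK; rewrite ?mem_head.
Qed.

(** Let R be the Rees algebra and X its element x in degree 1. Multiplication by X embeds R/(K : X),
    shifted by one degree, into R/K. The cokernel R/(K + XR) is a quotient of the Rees algebra of
    [s], by [lowc x s K 0]. *)
Lemma len_graded x s K n : graded (x :: s) K -> (forall n, fin (K n) (pw (x :: s) n)) ->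
  [/\ len (K n.+1) (pw (x :: s) n.+1) =
      (len (shiftc x s K n) (pw (x :: s) n) + len (lowc x s K 0 n.+1) (pw s n.+1))%N,
      fin (shiftc x s K n) (pw (x :: s) n) &
      fin (lowc x s K 0 n) (pw s n)].
Proof.
move=> [iK sK mK] fK.
have lowE m : lowc x s K 0 m = addI (K m) (mulI x (pwpred (x :: s) m)) `&` pw s m.
  apply/seteqP; split=> c.
    move=> [sc [p xp]]; rewrite expr0 expr1 mul1r addn0 => Kp; split=> //.
    by exists (c - x * p), (x * p); split=> //; [exists p|ring].
  move=> [[z [_ [Kz [p xp ->] ->]]] sc]; split=> //; exists p => //.
  by rewrite expr0 expr1 mul1r addn0 addrK.
have iM m : is_ideal (addI (K m) (mulI x (pwpred (x :: s) m))).
  by apply: ideal_addI => //; apply: ideal_mulI; exact: ideal_pwpred.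
have Msub m : addI (K m) (mulI x (pwpred (x :: s) m)) `<=` pw (x :: s) m.
  apply: addI_sub => //; first exact: ideal_pw.
  case: m => [|m]; first by rewrite pw0.
  by apply: subIaddr; exact: ideal_pw.
have KM m : K m `<=` addI (K m) (mulI x (pwpred (x :: s) m)).
  by apply: subIaddl; apply: ideal_mulI; exact: ideal_pwpred.
have pwE m : addI (addI (K m) (mulI x (pwpred (x :: s) m))) (pw s m) = pw (x :: s) m.
  apply/seteqP; split.
    by apply: addI_sub; [exact: ideal_pw|exact: Msub|exact: pw_consW].
  move=> z /pw_cons[c [p [sc xp ->]]]; exists (x * p), c; rewrite addrC; split=> //.
  by apply: subIaddr => //; exists p.
split.
- rewrite (len_add (iK n.+1) (iM n.+1) (ideal_pw _ _) (KM n.+1) (Msub n.+1) (fK n.+1)).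
  congr (_ + _)%N; first by rewrite len_mulI//; exact: ideal_pw.
  by rewrite lowE -len_addI//; [rewrite pwE|exact: ideal_pw].
- apply/fin_mulI => //; first exact: ideal_pw.
  by apply: fin_sub (fK n.+1) => //; exact: (Msub n.+1).
rewrite lowE; apply/fin_addI => //; first exact: ideal_pw.
by rewrite pwE; apply: fin_sub (fK n) => //; exact: KM.
Qed.

(** Induction on the generators. The iterated colons [KT t] of K by x stabilise at some T. There
    [len_graded] expresses the difference of consecutive lengths by the Hilbert function of an ideal
    over [s], which is polynomial. The same identity then leads back from T to 0. *)
Lemma hilbert_serre s K : noetherian A -> graded s K ->
  (forall n, fin (K n) (pw s n)) -> evpoly (size s) (fun n => len (K n) (pw s n)).
Proof.
move=> noe; elim: s K => [|x s IHs] K gK fK.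
  exists 0; first by rewrite size_poly0.
  exists 1%N => -[//|n] _; rewrite horner0.
  case: (gK) => iK sK _; suff -> : K n.+1 = [set 0].
    apply/eqP; rewrite pnatr_eq0 -leqn0; apply: (len_bound _).2 => -[//|k] /= [L [iL [_ h] L0 _]].
    by exfalso; apply: h.
  by apply/seteqP; split; [exact: sK|move=> _ ->; exact: ideal_0].
pose KT t := iter t (shiftc x s) K.
have gT t : graded (x :: s) (KT t) by elim: t => //= t IH; exact: graded_shiftc.
have fT t : forall n, fin (KT t n) (pw (x :: s) n).
  elim: t => //= t IH n; have [] := len_graded n (gT t) IH.
  by [].
have lowP t : evpoly (size s) (fun n => len (lowc x s (KT t) 0 n) (pw s n)).
  by apply: IHs => [|n]; [exact: graded_lowc|have [] := len_graded n (gT t) (fT t)].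
have hE t n : (len (KT t n.+1) (pw (x :: s) n.+1) = len (KT t.+1 n) (pw (x :: s) n) +
   len (lowc x s (KT t) 0 n.+1) (pw s n.+1))%N.
  by have [] := len_graded n (gT t) (fT t).
have [T hT] := graded_acc noe gT (fun t n => @sub_shiftc x s (KT t) n (gT t)).
have base : evpoly (size s).+1 (fun n => len (KT T n) (pw (x :: s) n)).
  apply: evpoly_diff (evpoly_shift (lowP T)) _ => n.
  by rewrite hE hT.
have : forall t, (t <= T)%N -> evpoly (size s).+1 (fun n => len (KT (T - t)%N n) (pw (x :: s) n)).
  elim=> [|t IH] tT; first by rewrite subn0.
  apply: evpoly_step (leqnSn _) (hE _) _ (lowP _).
  have -> : (T - t.+1).+1 = (T - t)%N by lia.
  by apply: IH; exact: ltnW.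
by move=> /(_ _ (leqnn T)); rewrite subnn.
Qed.

(** The differences are the lengths of Q^(n+1)/Q^(n+2), which come from [hilbert_serre] applied to
    the graded ideal with components [pw s n.+1]; its quotient is the associated graded ring. *)
Lemma hilbert_samuel s : noetherian A -> (forall n, fin (pw s n) setT) ->
  evpoly (size s).+1 (fun n => len (pw s n.+1) setT).
Proof.
move=> noe fA.
apply: (@evpoly_diff _ _ (fun n => len (pw s n.+2) (pw s n.+1))); last first.
  move=> n; rewrite addnC; apply: len_add => //; try exact: ideal_pw.
  exact: pwS_sub.
apply: (@evpoly_shift _ (fun n => len (pw s n.+1) (pw s n))).
apply: hilbert_serre => //.
  split=> [n|n|y n z]; [exact: ideal_pw|exact: pwS_sub|exact: pw_mem].
by move=> n; exact: fin_sub (fA n.+1).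
Qed.

End Rees.

(** * Comparison of eventually polynomial functions *)

Section PolyGrowth.
Implicit Types p q : {poly rat}.

Lemma lead_coef_gt0_ev p : 0 < lead_coef p ->
  exists2 e : rat, 0 < e & exists N, forall n, (N <= n)%N -> e <= p.[n%:R].
Proof.
elim/poly_ind: p => [|q c IH]; first by rewrite lead_coef0 ltxx.
have [-> |q0] := eqVneq q 0.
  by rewrite mul0r add0r lead_coefC => c0; exists c => //; exists 0%N => n _; rewrite hornerC.
have sq : (size c%:P < size (q * 'X)%R)%N.
  rewrite size_mulX// ltnS (leq_trans (size_polyC_leq1 _))// lt0n size_poly_eq0 //.
rewrite lead_coefDl// lead_coefMX => /IH[e e0 [N hN]].
(* For such n the term n e is at least |c| + e, so it absorbs c and leaves e. *)
exists e => //; exists (maxn N (Num.bound ((`|c| + e) / e))) => n.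
rewrite geq_max => /andP[Nn Mn].
have h1 : (`|c| + e) / e <= n%:R.
  rewrite (@le_trans _ _ (Num.bound ((`|c| + e) / e))%:R) ?ler_nat//.
  by rewrite ltW// archi_boundP// divr_ge0 ?addr_ge0// ltW.
have h2 : `|c| + e <= n%:R * e by rewrite -ler_pdivrMr.
have h3 : n%:R * e <= q.[n%:R] * n%:R by rewrite mulrC ler_wpM2r// hN.
have h4 : - `|c| <= c by rewrite lerNl ler_normr lexx orbT.
rewrite hornerD hornerMX hornerC; lra.
Qed.

Lemma lead_coef_ge0_ev p N : (forall n, (N <= n)%N -> 0 <= p.[n%:R]) -> 0 <= lead_coef p.
Proof.
move=> h; rewrite leNgt; apply/negP => p0.
have [|e e0 [M hM]] := @lead_coef_gt0_ev (- p); first by rewrite lead_coefN oppr_gt0.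
have := hM _ (leq_maxr N M); have := h _ (leq_maxl N M).
by rewrite hornerN; lra.
Qed.

Lemma poly_ev_inj p q N : (forall n, (N <= n)%N -> p.[n%:R] = q.[n%:R]) -> p = q.
Proof.
move=> h; apply/eqP; rewrite -subr_eq0 -lead_coef_eq0 eq_le.
rewrite -oppr_ge0 -lead_coefN; apply/andP; split; apply: (@lead_coef_ge0_ev _ N) => n /h E.
  by rewrite hornerN hornerD hornerN E subrr oppr0.
by rewrite hornerD hornerN E subrr.
Qed.

(** The comparison itself bounds the degree of p: if it exceeded d, then p >= 0 would give q - p a
    negative leading coefficient. This form suits the Hilbert polynomial of [m], for which no degree
    bound is at hand. *)
Lemma poly_ev_le_coef d p q N : (size q <= d.+1)%N ->
  (forall n, (N <= n)%N -> 0 <= p.[n%:R] <= q.[n%:R]) -> p`_d <= q`_d.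
Proof.
move=> sq h; have hr : 0 <= lead_coef (q - p).
  by apply: (@lead_coef_ge0_ev _ N) => n /h /andP[_]; rewrite hornerD hornerN subr_ge0.
case: (leqP (size p) d.+1) => sp.
  rewrite -subr_ge0 -coefB; have sr : (size (q - p)%R <= d.+1)%N.
    by rewrite (leq_trans (size_polyD _ _))// geq_max sq size_polyN.
  case: (eqVneq (size (q - p)) d.+1) => [E|ne]; first by move: hr; rewrite lead_coefE E.
  by rewrite nth_default// -ltnS ltn_neqAle ne.
exfalso; move: hr; rewrite addrC lead_coefDl ?size_polyN; last exact: leq_ltn_trans sp.
rewrite lead_coefN oppr_ge0 leNgt; apply/negP; rewrite negbK lt_neqAle eq_sym lead_coef_eq0.
rewrite -size_poly_gt0 (leq_trans _ sp)//=.
by apply: (@lead_coef_ge0_ev _ N) => n /h /andP[].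
Qed.

Lemma coef_comp_lin d p k c : (size p <= d.+1)%N -> k != 0 ->
  (p \Po (k *: 'X + c%:P))`_d = k ^+ d * p`_d /\ (size (p \Po (k *: 'X + c%:P))%R <= d.+1)%N.
Proof.
move=> sp k0.
have sl : size (k *: 'X + c%:P) = 2.
  by rewrite size_polyDl size_scale// size_polyX// (leq_ltn_trans (size_polyC_leq1 _)).
have lc : lead_coef (k *: 'X + c%:P) = k.
  by rewrite lead_coefDl ?lead_coefZ ?lead_coefX ?mulr1// size_scale// size_polyX (leq_ltn_trans (size_polyC_leq1 _)).
have sc := size_comp_poly2 p sl; rewrite sc; split=> //.
case: (eqVneq (size p) d.+1) => [E|ne].
  have := lead_coef_comp p (q := k *: 'X + c%:P); rewrite sl => /(_ isT).
  by rewrite lc !lead_coefE sc E /= mulrC.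
by rewrite !nth_default ?mulr0 ?sc// -ltnS ltn_neqAle ne.
Qed.

End PolyGrowth.

(** * Local rings *)

Section LocalRing.

Variable A : comNzRingType.
Implicit Types (I J L N Q : set A) (c g w x y z : A) (s t : seq A).

Lemma ideal_pow_le I x n k : is_ideal I -> I (x ^+ n) -> (n <= k)%N -> I (x ^+ k).
Proof. by move=> iI Ix nk; rewrite -(subnKC nk) exprD; apply: ideal_mulr. Qed.

Lemma ideal_radical I : is_ideal I -> is_ideal (radical I).
Proof.
move=> iI; split; first by exists 1%N; exact: ideal_0.
move=> a x y [n Ix] [k Iy]; exists (n + k)%N; rewrite exprDn.
apply: ideal_sum => // i _; rewrite -mulr_natl; apply: ideal_mull => //.
case: (leqP k i) => ki; first by apply: ideal_mull => //; exact: ideal_pow_le Iy ki.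
apply: ideal_mulr => //; rewrite exprMn; apply: ideal_mull => //.
by apply: ideal_pow_le Ix _ => //; lia.
Qed.

Lemma sub_radical I : I `<=` radical I.
Proof. by move=> x Ix; exists 1%N; rewrite expr1. Qed.

Lemma gen_pw_pow s w n : gen s w -> pw s n (w ^+ n).
Proof.
by move=> sw; elim: n => [|n IH]; [rewrite pw0|rewrite exprS; exact: pw_gen].
Qed.

(** The quotient of N + (y^n) by N + (y^(n+1)) is cyclic, generated by y^n, with annihilator (N :
    y^n) + (y). *)
Lemma len_pow N y n : is_ideal N -> fin (addI N (prin (y ^+ n.+1))) setT ->
  len (addI N (prin (y ^+ n.+1))) setT =
  (len (addI (colone N (y ^+ n)) (prin y)) setT + len (addI N (prin (y ^+ n))) setT)%N.
Proof.
move=> iN fT; set J := addI N (prin (y ^+ n.+1)).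
have iJ : is_ideal J by apply: ideal_addI => //; exact: ideal_prin.
have E : addI J (mulI (y ^+ n) setT) = addI N (prin (y ^+ n)).
  apply/seteqP; split.
    apply: addI_sub; first by apply: ideal_addI => //; exact: ideal_prin.
      apply: addI_mono => // _ [b _ ->]; exists (y * b) => //; rewrite exprS; ring.
    exact: subIaddr.
  by apply: addI_mono => //; apply: subIaddl; exact: ideal_prin.
have iE : is_ideal (addI N (prin (y ^+ n))) by apply: ideal_addI => //; exact: ideal_prin.
have JE : J `<=` addI N (prin (y ^+ n)).
  by rewrite -E; apply: subIaddl; exact: (ideal_prin (y ^+ n)).
rewrite (len_add iJ iE _ JE _ fT)//; congr (_ + _)%N.
rewrite -E len_mulI// setIT; congr (len _ _).
apply/seteqP; split=> z.
  move=> [u [_ [Nu [b _ ->] zE]]]; exists (z - b * y), (y * b).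
  split; [|by exists b|by ring].
  rewrite /colone /=; have -> : (z - b * y) * y ^+ n = u; last by [].
  by rewrite mulrBl zE exprS; ring.
move=> [u [_ [Nu [b _ ->] ->]]]; exists (u * y ^+ n), (y ^+ n.+1 * b).
by split=> //; [exists b|rewrite exprS; ring].
Qed.

Section Local.
Variable m : set A.
Hypotheses (noe : noetherian A) (loc : is_local m).

(** Otherwise dependent choice would produce a strictly ascending sequence of proper ideals above
    J. *)
Lemma exists_maximal J : is_ideal J -> ~ J 1 -> exists2 M, is_maximal M & J `<=` M.
Proof.
move=> iJ J1; apply: contrapT => no.
pose P := {M : set A | [/\ is_ideal M, ~ M 1 & J `<=` M]}.
have step (M : P) : exists M' : P, sval M `<` sval M'.
  case: M => M [iM M1 JM] /=; apply: contrapT => h; apply: no; exists M => //.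
  split=> // K iK K1 MK; apply: contrapT => ne; apply: h.
  have MK' : M `<` K by apply: properset_neq => // E; apply: ne.
  by exists (exist _ K (And3 iK K1 (subset_trans JM MK))).
have [f hf] := choice step.
pose F i := iter i f (exist _ J (And3 iJ J1 (fun x Jx => Jx)) : P).
have [|i|T hT] := @noetherian_acc _ (fun i => sval (F i)) noe.
- by move=> i; case: (F i) => ? [].
- by case: (hf (F i)).
have [_ h] := hf (F T); apply: h.
by have := hT T.+1 (leqnSn T); rewrite /F /= => ->.
Qed.

Lemma ideal_m : is_ideal m. Proof. by case: loc => -[]. Qed.
Lemma m_proper : ~ m 1. Proof. by case: loc => -[]. Qed.

Lemma proper_sub_m J : is_ideal J -> ~ J 1 -> J `<=` m.
Proof.
by move=> iJ J1; have [M mM] := exists_maximal iJ J1; case: loc => _ /(_ _ mM) ->.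
Qed.

Lemma unit_notin x : ~ m x -> exists v, v * x = 1.
Proof.
move=> mx; apply: contrapT => h; apply: mx.
apply: (proper_sub_m (ideal_prin x)); last exact: prin_id.
by move=> [v _ E]; apply: h; exists v; rewrite mulrC.
Qed.

Lemma unit_1B x : m x -> exists v, v * (1 - x) = 1.
Proof.
move=> mx; apply: unit_notin => m1; apply: m_proper.
have -> : 1 = (1 - x) + x by ring.
exact: ideal_add ideal_m m1 mx.
Qed.

Lemma unit_cancel J v x y : is_ideal J -> v * x = 1 -> J (x * y) -> J y.
Proof.
by move=> iJ vx Jxy; rewrite -[y]mul1r -vx -mulrA; apply: ideal_mull.
Qed.

Lemma m_expr x n : m (x ^+ n) -> m x.
Proof.
move=> mxn; apply: contrapT => /unit_notin[v vx]; apply: m_proper.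
by rewrite -(expr1n _ n) -vx exprMn; apply: ideal_mull ideal_m _.
Qed.

Lemma len_residue : fin m setT /\ (len m setT <= 1)%N.
Proof.
apply: len_bound => -[|[|n]] //= [K [iK /propersetP[mK [z Kz nmz]] _ [L [iL [_ h] _ _]]]].
exfalso; apply: h => x _; have [v vz] := unit_notin nmz.
by rewrite -[x]mulr1 -vz; apply: ideal_mull => //; exact: ideal_mull.
Qed.

(** In the filtration J + (x^i), each successive quotient is an image of A/(J + (x)) under
    multiplication by x^i. *)
Lemma fin_step J x n : is_ideal J -> fin (addI J (prin x)) setT -> J (x ^+ n) -> fin J setT.
Proof.
move=> iJ fJ Jx.
have i2 y : is_ideal (addI J (prin y)) by apply: ideal_addI => //; exact: ideal_prin.
suff H i : fin (addI J (prin (x ^+ i))) setT.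
  have := H n; congr fin; apply/seteqP; split; last by apply: subIaddl; exact: ideal_prin.
  by apply: addI_sub => //; exact: prin_sub.
elim: i => [|i IH].
  apply: fin_sub len_residue.1 => // y _; apply: subIaddr => //.
  by exists y; rewrite ?mul1r.
have s2 : addI J (prin (x ^+ i.+1)) `<=` addI J (prin (x ^+ i)).
  by apply: addI_monor => _ [b _ ->]; exists (x * b); rewrite // exprSr mulrA.
apply: (fin_trans (i2 _) (i2 (x ^+ i)) _ s2) => //.
have E : addI J (prin (x ^+ i)) = addI (addI J (prin (x ^+ i.+1))) (mulI (x ^+ i) setT).
  apply/seteqP; split; first by apply: addI_mono => //; apply: subIaddl; exact: ideal_prin.
  by apply: addI_sub => //; exact: subIaddr.
rewrite E; apply/fin_mulI => //; apply: fin_sub fJ => //.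
rewrite setIT; apply: addI_sub; first exact: ideal_colone.
  by move=> y Jy; apply: subIaddl; [exact: ideal_prin|exact: ideal_mulr].
move=> _ [b _ ->]; apply: subIaddr => //; exists b => //; rewrite exprS; ring.
Qed.

(** Generators of m are moved into J one at a time, each with [fin_step], until J contains m. *)
Lemma fin_primary J : is_ideal J -> (forall w, m w -> radical J w) -> fin J setT.
Proof.
move=> iJ rJ; have [t mE] := noe ideal_m; rewrite ideal_spanE in mE.
have {rJ} rJ w : w \in t -> radical J w by move=> /mem_gen; rewrite -mE; exact: rJ.
have mJ : m `<=` addI J (gen t) by rewrite mE; exact: subIaddr.
elim: t J iJ {mE} rJ mJ => [|x t IH] J iJ rJ mJ.
  apply: fin_sub len_residue.1 => //; apply: subset_trans mJ _.
  by apply: addI_sub => // _ ->; exact: ideal_0.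
have [n Jn] := rJ x (mem_head _ _); apply: fin_step Jn => //.
have iJx : is_ideal (addI J (prin x)) by apply: ideal_addI => //; exact: ideal_prin.
apply: IH => //.
  move=> w wt; have [|k Jk] := rJ w; first by rewrite inE wt orbT.
  by exists k; apply: subIaddl => //; exact: ideal_prin.
apply: subset_trans mJ _ => _ [u [_ [Ju [p [q [xp tq ->]] ->]]]].
by exists (u + p), q; split=> //; [exists u, p|rewrite addrA].
Qed.

Definition sop s : Prop := radical (gen s) = m.

Lemma sop_sub s : sop s -> gen s `<=` m.
Proof. by move=> <-; exact: sub_radical. Qed.

Lemma sop_mem s x : sop s -> x \in s -> m x.
Proof. by move=> ss /mem_gen; exact: sop_sub. Qed.

Lemma sop_of s t : sop s -> (forall x, x \in s -> radical (gen t) x) ->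
  (forall x, x \in t -> m x) -> sop t.
Proof.
move=> ss st tm; apply/seteqP; split.
  by move=> x [n tx]; apply: (@m_expr _ n); apply: (gen_sub ideal_m tm).
rewrite -ss => x [n sx].
have [k tk] : radical (gen t) (x ^+ n).
  by apply: (gen_sub _ st) => //; apply: ideal_radical; exact: ideal_gen.
by exists (n * k)%N; rewrite exprM.
Qed.

Lemma sop_eqi s t : sop s -> s =i t -> sop t.
Proof. by rewrite /sop => + /gen_eqi <-. Qed.

Lemma fin_sop s : sop s -> fin (gen s) setT.
Proof. by move=> ss; apply: fin_primary => [|w]; [exact: ideal_gen|rewrite -ss]. Qed.

Lemma fin_pw s n : sop s -> fin (pw s n) setT.
Proof.
move=> ss; apply: fin_primary => [|w]; first exact: ideal_pw.
by rewrite -ss => -[k sw]; exists (k * n)%N; rewrite exprM; exact: gen_pw_pow.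
Qed.

End Local.
End LocalRing.

(** * Multiplicities of powers of parameters *)

Section PowerIdeals.

Variable A : comNzRingType.
Implicit Types (I J L : set A) (c g w x y z : A) (s t : seq A).

Lemma addIC I J : addI I J = addI J I.
Proof. by apply/seteqP; split=> _ [x [y [? ? ->]]]; exists y, x; rewrite addrC. Qed.

Lemma gen_cons x s : gen (x :: s) = addI (gen s) (prin x).
Proof. exact: addIC. Qed.

Definition pows k s : seq A := [seq x ^+ k | x <- s].

(** (x, s)^n is the sum of the ideals x^j (s)^(n-j), so an inclusion can be tested on these. *)
Lemma pw_sub_ind x s n J : is_ideal J ->
  (forall j c, (j <= n)%N -> pw s (n - j) c -> J (x ^+ j * c)) -> pw (x :: s) n `<=` J.
Proof.
elim: n J => [|n IH] J iJ h.
  by move=> c _; rewrite -[c]mul1r -(expr0 x); apply: h; rewrite // pw0.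
rewrite pwS; apply: addI_sub => //.
  by move=> c sc; rewrite -[c]mul1r -(expr0 x); apply: h.
move=> _ [p xp ->]; rewrite mulrC.
apply: (IH (colone J x)) xp => [|j c jn sc]; first exact: ideal_colone.
by rewrite /colone /= mulrAC -exprSr; apply: h.
Qed.

Lemma pw_expM x s a b c : pw s a c -> pw (x :: s) (b + a) (x ^+ b * c).
Proof.
move=> sc; elim: b => [|b IH]; first by rewrite expr0 mul1r; exact: pw_consW.
by rewrite exprS -mulrA addSn; apply: (@pw_mem _ (x :: s)); rewrite ?mem_head.
Qed.

Lemma pw_anti s a b : (a <= b)%N -> pw s b `<=` pw s a.
Proof.
move=> ab; rewrite -(subnKC ab); elim: (b - a)%N => [|k IH]; first by rewrite addn0.
by rewrite addnS; apply: subset_trans IH; exact: pwS_sub.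
Qed.

Lemma pw_pows_sub k s n : pw (pows k s) n `<=` pw s (k * n).
Proof.
elim: s n => [|x s IH] n.
  by case: n => [|n]; rewrite ?muln0// => z ->; apply: ideal_0; exact: ideal_pw.
apply: pw_sub_ind => [|j c jn /IH sc]; first exact: ideal_pw.
rewrite -exprM; have -> : (k * n)%N = (k * j + k * (n - j))%N by rewrite -mulnDr subnKC.
exact: pw_expM.
Qed.

(** Pigeonhole: writing an exponent as j = qk + r with r < k yields q factors x^k and wastes at most
    k - 1 factors for each generator. *)
Lemma sub_pw_pows k s n M : (0 < k)%N -> (k * n + size s * k.-1 <= M)%N ->
  pw s M `<=` pw (pows k s) n.
Proof.
move=> k0; elim: s n M => [|x s IH] n M /=.
  case: n => [|n] hM; first by [].
  case: M hM => [|M] hM; first by exfalso; nia.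
  by move=> _ ->; exact: ideal_0 (ideal_pw [::] n.+1).
move=> hM; apply: pw_sub_ind => [|j c jM sc]; first exact: (ideal_pw (pows k (x :: s))).
have rk := ltn_pmod j k0; have jE := divn_eq j k.
have {}sc : pw (pows k s) (n - j %/ k) c.
  case: (leqP n (j %/ k)) => [/eqnP ->|qn]; first by rewrite pw0.
  have qk : (j %/ k * k <= k * n)%N by rewrite mulnC leq_mul2l ltnW ?orbT.
  apply: IH sc; rewrite mulnBr [(k * (j %/ k))%N]mulnC; move: hM qk; rewrite mulSn.
  move: rk jE; move: (j %% k)%N (j %/ k * k)%N (size s * _)%N (k * n)%N => r q a b rk jE.
  move: k0 rk jM; rewrite jE; clear; lia.
rewrite jE mulnC exprD mulrAC exprM; apply: ideal_mulr; first exact: (ideal_pw (pows k (x :: s))).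
have := pw_expM (x ^+ k) (j %/ k) sc; apply: (@pw_anti (pows k (x :: s))); lia.
Qed.

Section Mult.
Variables (m : set A) (d : nat).
Hypotheses (noe : noetherian A) (loc : is_local m).

(** Polynomials that agree at all large integers are equal, so the [xget] in [hilbert_samuel_poly]
    can only pick the polynomial of [hilbert_samuel]. *)
Lemma mult_poly s : size s = d -> sop m s ->
  exists2 p : {poly rat}, (size p <= d.+1)%N /\ multiplicity d (gen s) = d`!%:R * p`_d &
    exists N, forall n, (N <= n)%N -> (len (pw s n.+1) setT)%:R = p.[n%:R].
Proof.
move=> sd ss; have [p sp [N pE]] := hilbert_samuel noe (fun n => fin_pw noe loc n ss).
rewrite sd in sp; exists p; last by exists N.
split=> //; rewrite /multiplicity; suff -> : hilbert_samuel_poly (gen s) = p by [].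
rewrite /hilbert_samuel_poly.
have lE n : length setT (ideal_exp (gen s) n.+1) = ((len (pw s n.+1) setT)%:R)%:E.
  by rewrite pw_exp lengthE//; [exact: ideal_pw|exact: fin_pw ss].
case: xgetP => [q -> [M qE]|/(_ p) no].
  apply: (@poly_ev_inj _ _ (maxn N M)) => n; rewrite geq_max => /andP[Nn Mn].
  by have := qE n Mn; rewrite lE pE// => -[->].
by exfalso; apply: no; exists N => n Nn; rewrite lE pE.
Qed.

Lemma sop_pows k s : (0 < k)%N -> sop m s -> sop m (pows k s).
Proof.
move=> k0 ss; apply: sop_of (ss) _ _ => // x.
  by move=> xs; exists k; apply: mem_gen; apply/mapP; exists x.
case/mapP => y ys ->; rewrite -(prednK k0) exprS; apply: ideal_mulr (ideal_m loc) _.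
exact: sop_mem ss ys.
Qed.

Lemma sop_pow1 k y s : (0 < k)%N -> sop m (y :: s) -> sop m (y ^+ k :: s).
Proof.
move=> k0 ss; apply: sop_of (ss) _ _ => // x; rewrite inE => /orP[/eqP ->|xs].
- by exists k; apply: mem_gen; rewrite mem_head.
- by apply: sub_radical; apply: mem_gen; rewrite inE xs orbT.
- rewrite -(prednK k0) exprS; apply: ideal_mulr (ideal_m loc) _.
  by apply: sop_mem ss _; rewrite mem_head.
- by apply: sop_mem ss _; rewrite inE xs orbT.
Qed.

Lemma mult_pows k s : (0 < k)%N -> size s = d -> sop m s ->
  multiplicity d (gen (pows k s)) = k%:R ^+ d * multiplicity d (gen s).
Proof.
move=> k0 sd ss; have sk := sop_pows k0 ss.
have [p [sp ->] [N pE]] := mult_poly sd ss.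
have [|q [sq ->] [M qE]] := @mult_poly (pows k s) _ sk; first by rewrite size_map.
have kn0 : k%:R != 0 :> rat by rewrite pnatr_eq0 -lt0n.
(* [P c] is p(kX + c). The two inclusions between powers place q between the cases c = k - 1 and c =
   k - 1 + d(k - 1), and both have k^d p_d as coefficient of degree d. *)
pose P (c : nat) := p \Po (k%:R *: 'X + (c%:R)%:P).
have PE (c n : nat) : (P c).[n%:R] = p.[(k * n + c)%:R].
  by rewrite horner_comp !hornerE natrD natrM.
have [c1 s1] := coef_comp_lin (k.-1)%:R sp kn0.
have [c2 s2] := coef_comp_lin (k.-1 + d * k.-1)%:R sp kn0.
suff qd : q`_d = k%:R ^+ d * p`_d by rewrite qd; ring.
have kk n : (k * n.+1 = (k * n + k.-1).+1)%N by rewrite mulnS; lia.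
have kn n : (n <= k * n)%N by rewrite leq_pmull.
apply/eqP; rewrite eq_le -{1}c2 -{1}c1; apply/andP; split.
  apply: (@poly_ev_le_coef _ _ _ (maxn N M)) => // n; rewrite geq_max => /andP[Nn Mn].
  rewrite -/(P _) PE -qE// -pE; last by have := kn n; lia.
  rewrite ler0n ler_nat; apply: len_mono => //; first exact: fin_pw ss.
  apply: sub_pw_pows => //; rewrite sd kk; lia.
apply: (@poly_ev_le_coef _ _ _ (maxn N M)) => // n; rewrite geq_max => /andP[Nn Mn].
rewrite -/(P _) PE -qE// -pE; last by have := kn n; lia.
rewrite ler0n ler_nat; apply: len_mono => //; first exact: fin_pw sk.
rewrite -kk; exact: pw_pows_sub.
Qed.

(** * Parameters when l(A/Q) - e(Q) is a constant C *)

Variable C : rat.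
Hypothesis d_gt0 : (0 < d)%N.
Hypothesis buch : forall s, size s = d -> sop m s ->
  (len (gen s) setT)%:R = multiplicity d (gen s) + C.

Lemma len_gen_pow_le n y s : (0 < n)%N -> sop m (y :: s) ->
  (len (gen (y ^+ n :: s)) setT <= n * len (gen (y :: s)) setT)%N.
Proof.
move=> n0 ss; elim: n n0 => // n IH _; case: (posnP n) => [->|n0].
  by rewrite expr1 mul1n.
have f1 := fin_sop noe loc (sop_pow1 (ltn0Sn n) ss).
rewrite [gen (y ^+ n.+1 :: s)]gen_cons len_pow; [|exact: ideal_gen|by rewrite -gen_cons].
rewrite mulSn; apply: leq_add; last by rewrite -gen_cons; exact: IH.
apply: len_mono => //; first exact: fin_sop ss.
rewrite gen_cons; apply: addI_mono => // z; exact: ideal_mulr (ideal_gen s).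
Qed.

(** Apply [len_gen_pow_le] to the k-th powers of all the parameters. Both multiplicities are scaled
    by k^d while C stays fixed, so for large k only the multiplicities matter. *)
Lemma mult_pow_le n y s : (0 < n)%N -> size (y :: s) = d -> sop m (y :: s) ->
  multiplicity d (gen (y ^+ n :: s)) <= n%:R * multiplicity d (gen (y :: s)).
Proof.
move=> n0 sd ss; have sn := sop_pow1 n0 ss.
set E1 := multiplicity d (gen (y ^+ n :: s)); set E2 := multiplicity _ _.
have key k : (0 < k)%N -> k%:R ^+ d * E1 + C <= n%:R * (k%:R ^+ d * E2 + C).
  move=> k0; rewrite /E1 /E2 -!mult_pows// -!buch ?size_map//; try exact: sop_pows.
  rewrite -natrM ler_nat /= -exprM mulnC exprM; apply: len_gen_pow_le => //.
  exact: (sop_pows k0 ss).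
rewrite leNgt; apply/negP => lt; set D := E1 - n%:R * E2.
have D0 : 0 < D by rewrite subr_gt0.
(* As d > 0, k^d >= k > B, so k^d D exceeds nC - C, against [key]. *)
pose B := (n%:R * C - C) / D; pose k := (Num.bound `|B|).+1.
have kB : B < k%:R.
  apply: le_lt_trans (ler_norm B) _; apply: lt_le_trans (archi_boundP (normr_ge0 B)) _.
  by rewrite ler_nat.
have k1 : (k%:R : rat) <= k%:R ^+ d.
  by rewrite -natrX ler_nat -{1}(expn1 k) leq_pexp2l.
have : B < k%:R ^+ d by apply: lt_le_trans k1.
rewrite ltr_pdivrMr// => h; have := key k isT; move: h; rewrite /D; nra.
Qed.

(* With [p = [:: y ^+ n]] this gives e(s^n) <= n^(d-1) e(y^n, s'), the lower bound
   for e(y^n, s') in [mult_pow], because e(s^n) = n^d e(s). *)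
Lemma mult_pows_le n p q : (0 < n)%N -> size (p ++ q) = d -> sop m (p ++ q) ->
  multiplicity d (gen (p ++ pows n q)) <= n%:R ^+ size q * multiplicity d (gen (p ++ q)).
Proof.
move=> n0; elim: q p => [|x q IH] p sd ss; first by rewrite cats0 expr0 mul1r.
have e y t : gen (p ++ y :: t) = gen (y :: (p ++ t)).
  by apply: gen_eqi => z; rewrite !(mem_cat, inE) orbCA.
have ss' : sop m (x :: (p ++ q)) by rewrite /sop -e.
have sd' : size (x :: (p ++ q)) = d by rewrite -sd /= !size_cat addnS.
have := IH (rcons p (x ^+ n)); rewrite !cat_rcons => h.
apply: le_trans (h _ _) _; first by rewrite -sd !size_cat.
  by rewrite /sop e; exact: sop_pow1.
rewrite !e /= exprSr -mulrA ler_wpM2l ?exprn_ge0//; exact: mult_pow_le.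
Qed.

Lemma mult_pow n y s : (0 < n)%N -> size (y :: s) = d -> sop m (y :: s) ->
  multiplicity d (gen (y ^+ n :: s)) = n%:R * multiplicity d (gen (y :: s)).
Proof.
move=> n0 sd ss; apply/eqP; rewrite eq_le mult_pow_le//=.
have : multiplicity d (gen (pows n (y :: s))) <= n%:R ^+ size s * multiplicity d (gen (y ^+ n :: s)).
  exact: (@mult_pows_le n [:: y ^+ n] s n0 sd (sop_pow1 n0 ss)).
rewrite mult_pows//; have -> : n%:R ^+ d = n%:R ^+ size s * n%:R :> rat by rewrite -sd /= exprSr.
by rewrite -mulrA ler_pM2l// exprn_gt0// ltr0n.
Qed.

Lemma len_gen_pow n y s : (0 < n)%N -> size (y :: s) = d -> sop m (y :: s) ->
  (len (gen (y ^+ n :: s)) setT)%:R = n%:R * multiplicity d (gen (y :: s)) + C.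
Proof. by move=> n0 sd ss; rewrite buch// ?mult_pow//; exact: sop_pow1. Qed.

(** By [len_pow] this length is the difference of two consecutive values in [len_gen_pow], where C
    cancels. *)
Lemma len_colon_pow n y s : (0 < n)%N -> size (y :: s) = d -> sop m (y :: s) ->
  (len (addI (colone (gen s) (y ^+ n)) (prin y)) setT)%:R = multiplicity d (gen (y :: s)).
Proof.
move=> n0 sd ss; have f1 := fin_sop noe loc (sop_pow1 (ltn0Sn n) ss).
have := len_gen_pow (ltn0Sn n) sd ss; rewrite [gen (y ^+ n.+1 :: s)]gen_cons.
rewrite len_pow; [|exact: ideal_gen|by rewrite -gen_cons].
by rewrite -gen_cons natrD len_gen_pow// -natr1; lra.
Qed.

Lemma colone_anti J x k n : is_ideal J -> (k <= n)%N -> colone J (x ^+ k) `<=` colone J (x ^+ n).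
Proof.
by move=> iJ kn z; rewrite /colone /= -(subnKC kn) exprD mulrA => Jz; exact: ideal_mulr.
Qed.

(** With N = [gen s], the ideals U n = N : y^n increase, and by [len_colon_pow] the ideals U n + (y)
    agree for n >= 1. If U is constant from T on, this gives U T = U 1 + y (U T). Iterating T times
    ends the proof, since y^T (U T) lies in N. *)
Lemma colone_pow_sop n y s : size (y :: s) = d -> sop m (y :: s) ->
  colone (gen s) (y ^+ n) `<=` colone (gen s) y.
Proof.
move=> sd ss; pose U n := colone (gen s) (y ^+ n).
have iU k : is_ideal (U k) by apply: ideal_colone; exact: ideal_gen.
have mU k l : (k <= l)%N -> U k `<=` U l by apply: colone_anti; exact: ideal_gen.
pose V n := addI (U n) (prin y).
have iV k : is_ideal (V k) by apply: ideal_addI => //; exact: ideal_prin.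
have VE k : (0 < k)%N -> V k = V 1%N.
  move=> k0; have V1k : V 1%N `<=` V k by apply: addI_mono => //; exact: mU.
  have f1 : fin (V 1%N) setT.
    apply: fin_sub (fin_sop noe loc ss) => //; rewrite gen_cons; apply: addI_mono => // z.
    exact: ideal_mulr (ideal_gen s).
  have E : len (V 1%N) setT = len (V k) setT.
    by apply/eqP; rewrite -(eqr_nat rat) !len_colon_pow.
  have := len_add (iV 1%N) (iV k) (@ideal_setT A) V1k (fun _ _ => Logic.I) f1.
  rewrite E => h; symmetry; apply: len_eq0 => //; first exact: fin_sub f1.
  by lia.
have [T0 hT0] := noetherian_acc noe iU (fun k => mU _ _ (leqnSn k)).
pose T := T0.+1; have hT k : (T <= k)%N -> U k = U T by move=> Tk; rewrite !hT0//; exact: ltnW.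
(* Write b = c + y b' with c in U 1. Then y b' lies in U T, so b' lies in U (T + 1) = U T and the
   expansion can continue. *)
have UT u k : U T u -> exists2 b, U T b & U 1%N (u - y ^+ k * b).
  move=> Uu; elim: k => [|k [b Ub h]].
    by exists u => //; rewrite expr0 mul1r subrr; exact: ideal_0.
  have : V 1%N b by rewrite -(VE T)//; apply: subIaddl Ub; exact: ideal_prin.
  move=> [c [_ [Uc [b' _ ->] bE]]]; exists b'.
    have : U T (y * b').
      have -> : y * b' = b - c by rewrite bE; ring.
      by apply: ideal_sub => //; exact: (mU 1%N T).
    move=> h'; rewrite -(hT T.+1)// /U /colone /=; have -> : b' * y ^+ T.+1 = y * b' * y ^+ T by rewrite exprS; ring.
    exact: h'.
  have -> : u - y ^+ k.+1 * b' = (u - y ^+ k * b) + y ^+ k * c by rewrite bE exprSr; ring.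
  by apply: ideal_add => //; exact: ideal_mull.
have UT1 : U T `<=` U 1%N.
  move=> u Uu; have [b Ub h] := UT u T Uu.
  have -> : u = (u - y ^+ T * b) + y ^+ T * b by ring.
  apply: ideal_add => //; rewrite mulrC /U /colone /=.
  exact: ideal_mulr (ideal_gen s) Ub.
have -> : colone (gen s) y = U 1%N by rewrite /U expr1.
apply: subset_trans UT1; case: (leqP n T) => nT; first exact: mU.
by rewrite -(hT n)// ltnW.
Qed.

(** Some power y'^k lies in (y) + N with N = [gen s], so N : y is contained in N : y'^k, hence in N
    : y'. *)
Lemma colone_sop_indep y y' s : size (y :: s) = d -> sop m (y :: s) -> sop m (y' :: s) ->
  colone (gen s) y `<=` colone (gen s) y'.
Proof.
move=> sd ss ss' u Nu.
have [k] : radical (gen (y :: s)) y' by rewrite ss; apply: sop_mem ss' _; rewrite mem_head.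
move=> [_ [c [[b _ ->] Nc E]]]; apply: (@colone_pow_sop k) => //.
rewrite /colone /= E mulrDr mulrA; apply: ideal_add; first exact: ideal_gen.
  exact: ideal_mulr (ideal_gen s) Nu.
exact: ideal_mull (ideal_gen s) Nc.
Qed.

End Mult.
End PowerIdeals.

(** * Socles of parameter ideals *)

Section Buchsbaum.

Variable A : comNzRingType.
Implicit Types (I J L : set A) (c g w x y z : A) (s t : seq A).

Definition omit (i : nat) s := take i s ++ drop i.+1 s.

Lemma size_omit i s : (i < size s)%N -> (size (omit i s)).+1 = size s.
Proof. by move=> lt; rewrite size_cat size_takel ?size_drop; lia. Qed.

Lemma mem_omit i s : (i < size s)%N -> s =i s`_i :: omit i s.
Proof.
move=> lt x; rewrite -{1}(cat_take_drop i s) (drop_nth 0 lt) /omit.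
by rewrite !(mem_cat, inE) orbCA.
Qed.

Lemma nth_omit i j s : (i < size s)%N -> (j < size s)%N -> j != i -> s`_j \in omit i s.
Proof.
move=> si sj ji; rewrite mem_cat; case: (ltnP j i) => lt.
  by rewrite -(nth_take 0 lt) mem_nth// size_takel// ltnW.
have lt' : (i < j)%N by rewrite ltn_neqAle eq_sym ji.
have -> : s`_j = (drop i.+1 s)`_(j - i.+1) by rewrite nth_drop subnKC.
by rewrite mem_nth ?orbT// size_drop ltn_sub2r// (leq_ltn_trans lt').
Qed.

Lemma sum_omit (i : nat) s (f : nat -> A) : (i < size s)%N ->
  exists2 r, gen (omit i s) r & \sum_(j < size s) f j * s`_j = f i * s`_i + r.
Proof.
move=> lt; exists (\sum_(j < size s | j != Ordinal lt) f j * s`_j).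
  apply: ideal_sum (ideal_gen _) _ => j ji; apply: ideal_mull (ideal_gen _) _.
  by apply: mem_gen; apply: nth_omit.
by rewrite (bigD1 (Ordinal lt)).
Qed.

Lemma gen_omit i s : (i < size s)%N -> gen s = gen (s`_i :: omit i s).
Proof. by move=> /mem_omit/gen_eqi. Qed.

Lemma ideal_exp_mono I J n : I `<=` J -> ideal_exp I n `<=` ideal_exp J n.
Proof.
move=> IJ; elim: n => [|n IH] //; rewrite /ideal_exp !iterS -!/(ideal_exp _ _).
apply: ideal_span_sub (ideal_span_ideal _) _ => _ [x [y [Ix ny ->]]].
by apply: sub_ideal_span; exists x, y; split; [exact: IJ|exact: IH|].
Qed.

Variables (m : set A) (d : nat).
Hypotheses (noe : noetherian A) (loc : is_local m).

Lemma ideal_exp_ideal n : is_ideal (ideal_exp m n).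
Proof. by case: n => [|n]; [|exact: ideal_span_ideal]. Qed.

(** Positivity rules out the default polynomial 0 in [hilbert_samuel_poly m]. The coefficients are
    then compared through the inclusion of Q^(n+1) in m^(n+1). *)
Lemma mult_m_le s : size s = d -> sop m s -> 0 < multiplicity d m ->
  multiplicity d m <= multiplicity d (gen s).
Proof.
move=> sd ss; have [q [sq ->] [N qE]] := mult_poly noe loc sd ss.
rewrite /multiplicity /hilbert_samuel_poly; case: xgetP => [p -> [M pE] _|_]; last first.
  by rewrite coef0 mulr0 ltxx.
rewrite ler_pM2l ?ltr0n ?fact_gt0//.
have sub n : pw s n `<=` ideal_exp m n.
  by rewrite -pw_exp; apply: ideal_exp_mono; exact: sop_sub ss.
apply: (@poly_ev_le_coef _ _ _ (maxn N M)) => // n; rewrite geq_max => /andP[Nn Mn].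
have f := fin_pw noe loc n.+1 ss.
have := pE n Mn; rewrite lengthE//; first last.
- exact: fin_sub f.
- exact: ideal_exp_ideal.
by move=> [<-]; rewrite -qE// ler0n ler_nat; apply: len_mono.
Qed.

Lemma parameter_gen s : size s = d -> sop m s -> parameter_ideal m d (gen s).
Proof.
move=> sd ss; pose x : d.-tuple A := @Tuple d A s (introT eqP sd).
have xE : ideal_span [set` x] = gen s by rewrite -ideal_spanE.
by exists x; rewrite /is_sop xE.
Qed.

Lemma parameter_list Q : parameter_ideal m d Q ->
  exists s, [/\ size s = d, sop m s & Q = gen s].
Proof.
move=> [x xs ->]; exists (tval x); rewrite size_tuple.
have xE : ideal_span [set` x] = gen x by rewrite -ideal_spanE.
by split=> //; rewrite /sop -xE.
Qed.

(** * Colon ideals of d - 1 parameters *)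

Variable C : rat.
Hypothesis d_gt0 : (0 < d)%N.
Hypothesis buch : forall s, size s = d -> sop m s ->
  (len (gen s) setT)%:R = multiplicity d (gen s) + C.

Let colone_pow n y s := @colone_pow_sop A m d noe loc C d_gt0 buch n y s.
Let colone_indep y y' s := @colone_sop_indep A m d noe loc C d_gt0 buch y y' s.
Let len_colon n y s := @len_colon_pow A m d noe loc C d_gt0 buch n y s.

(** Replaces prime avoidance. If each X_n = w + y^(n+1) kills some b_n outside H modulo H, the chain
    condition puts some b_T in H + (b_0, ..., b_(T-1)), so X_0 ... X_(T-1) b_T lies in H. Since X_T
    b_T is in H, and X_n - X_T is y^(n+1) times a unit for n < T, where y is regular modulo H, the
    factors X_n cancel one by one and b_T lies in H. *)
Lemma exists_regular_shift w y s : size (y :: s) = d -> sop m (y :: s) -> m w ->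
  exists n, forall b, colone (gen s) y ((w + y ^+ n.+1) * b) -> colone (gen s) y b.
Proof.
move=> sd ss mw; have my : m y by apply: sop_mem ss _; rewrite mem_head.
set H := colone (gen s) y; have iH : is_ideal H by apply: ideal_colone; exact: ideal_gen.
have Hpow n b : H (y ^+ n * b) -> H b.
  move=> h; apply: (@colone_pow n.+1 y s sd ss); move: h; rewrite /H /colone /=.
  by rewrite exprSr mulrA [b * _]mulrC.
pose X n := w + y ^+ n.+1.
apply: contrapT => no.
have [n|b hb] := @choice nat A (fun n c => H (X n * c) /\ ~ H c).
  apply: contrapT => h; apply: no; exists n => c Hc.
  by apply: contrapT => nc; apply: h; exists c.
pose S := fix S n := if n is n'.+1 then addI (S n') (prin (b n')) else H.
have iS n : is_ideal (S n).
  by elim: n => //= n IH; apply: ideal_addI => //; exact: ideal_prin.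
have [|T hT] := noetherian_acc noe iS.
  by move=> n /=; apply: subIaddl; exact: ideal_prin.
have STb : S T (b T).
  by rewrite -(hT T.+1)//=; apply: subIaddr => //; exact: prin_id.
have SX n z : S n z -> H ((\prod_(i < n) X i) * z).
  elim: n z => [|n IH] z /=; first by rewrite big_ord0 mul1r.
  move=> [u [_ [Su [c _ ->] ->]]]; rewrite big_ord_recr /=.
  have -> : \prod_(i < n) X i * X n * (u + b n * c) =
    X n * (\prod_(i < n) X i * u) + (\prod_(i < n) X i * c) * (X n * b n) by ring.
  apply: ideal_add => //; apply: ideal_mull => //; first exact: IH.
  by case: (hb n).
have [HT nHT] := hb T; apply: nHT.
suff cancel n : (n <= T)%N -> H ((\prod_(i < n) X i) * b T) -> H (b T).
  exact: cancel (leqnn T) (SX _ _ STb).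
elim: n => [|n IH] nT; first by rewrite big_ord0 mul1r.
rewrite big_ord_recr /= => h; apply: IH; first exact: ltnW.
set p := \prod_(i < n) X i in h *.
apply: (@Hpow n.+1).
have [|v vE] := @unit_1B _ _ noe loc (y ^+ (T - n)).
  by rewrite -(subnSK nT) exprS; apply: ideal_mulr (ideal_m loc) _.
apply: (@unit_cancel _ _ v _ _ iH vE).
have -> : (1 - y ^+ (T - n)) * (y ^+ n.+1 * (p * b T)) = p * X n * b T - p * (X T * b T).
  have -> : X T = w + y ^+ n.+1 * y ^+ (T - n) by rewrite -exprD /X addSn subnKC// ltnW.
  by rewrite /X; ring.
by apply: ideal_sub => //; exact: ideal_mull.
Qed.

(** It suffices that a power of y lies in R = H + (x), because H y is contained in [gen s]. The
    ideals [Z n] = H + (y^(k+n)) + (x) decrease and have bounded colength, so two consecutive ones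
    coincide; a unit 1 - yc then gives the power. *)
Lemma sop_of_regular x y s : size (y :: s) = d -> sop m (y :: s) -> m x ->
  (forall b, colone (gen s) y (x * b) -> colone (gen s) y b) -> sop m (x :: s).
Proof.
move=> sd ss mx reg; have my : m y by apply: sop_mem ss _; rewrite mem_head.
set H := colone (gen s) y in reg; have iH : is_ideal H by apply: ideal_colone; exact: ideal_gen.
pose Y n := addI H (prin (y ^+ n)).
have iY n : is_ideal (Y n) by apply: ideal_addI => //; exact: ideal_prin.
have fY n : fin (Y n) setT.
  apply: (fin_primary noe loc) => // w.
  rewrite -ss => -[k [_ [h [[b _ ->] Nh wE]]]]; exists (k * n.+1)%N.
  have iR : is_ideal (addI (gen s) (prin (y ^+ n.+1))).
    by apply: ideal_addI; [exact: ideal_gen|exact: ideal_prin].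
  have : pw (y :: s) n.+1 (w ^+ (k * n.+1)).
    by rewrite exprM; apply: gen_pw_pow; exists (y * b), h; split=> //; exists b.
  suff : pw (y :: s) n.+1 `<=` Y n by apply.
  apply: pw_sub_ind => // j c jn sc; case: (leqP n j) => nj.
    rewrite -(subnKC nj) exprD -mulrA; apply: subIaddr => //.
    by exists (y ^+ (j - n) * c).
  have Nc : gen s c.
    by rewrite -pw1; apply: pw_anti sc; lia.
  apply: subIaddl; first exact: ideal_prin.
  apply: ideal_mull => //; exact: ideal_mulr (ideal_gen s) Nc.
pose R := addI H (prin x); have iR : is_ideal R by apply: ideal_addI => //; exact: ideal_prin.
have [||k hk] := @noetherian_acc _ (fun n => colone R (y ^+ n)) noe.
- by move=> n; exact: ideal_colone.
- by move=> n; apply: colone_anti.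
(* Artin-Rees for principal ideals: (y^n) meets (x) in y^(n-k) ((y^k) meets (x)). *)
have AR n : colone (Y (k + n)%N) x `<=` Y n.
  move=> b [h [_ [Hh [c _ ->] E]]].
  have : colone R (y ^+ (k + n)) c.
    exists (- h), (x * b); split; [exact: ideal_opp|by exists b|].
    by rewrite mulrC [x * b]mulrC E; ring.
  rewrite (hk (k + n)%N (leq_addr _ _)) => -[h' [_ [Hh' [b' _ ->] E']]].
  exists (b - y ^+ n * b'), (y ^+ n * b'); split; [|by exists b'|by ring].
  apply: reg; have -> : x * (b - y ^+ n * b') = h + y ^+ n * h'.
    have -> : x * (b - y ^+ n * b') = b * x - y ^+ n * (x * b') by ring.
    rewrite E exprD; have -> : x * b' = c * y ^+ k - h' by rewrite E'; ring.
    ring.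
  by apply: ideal_add => //; exact: ideal_mull.
pose Z n := addI (Y (k + n)%N) (mulI x setT).
have iZ n : is_ideal (Z n) by apply: ideal_addI => //; exact: ideal_prin.
have YZ n : Y (k + n)%N `<=` Z n by apply: subIaddl; exact: (ideal_prin x).
(* With Y = [Y (k + n)], A/(Y : x) is isomorphic to [Z n]/Y, so l(A/[Z n]) = l((Y : x)/Y). By [AR]
   this is at most l([Y n]/Y), and [Y n]/Y is generated by y^n and killed by [Y k]. *)
have bound n : (len (Z n) setT <= len (Y k) setT)%N.
  have e1 := len_add (iY (k + n)%N) (iZ n) (@ideal_setT A) (YZ n) (fun _ _ => Logic.I) (fY _).
  have iC : is_ideal (colone (Y (k + n)%N) x) by exact: ideal_colone.
  have sC : Y (k + n)%N `<=` colone (Y (k + n)%N) x by move=> z; exact: ideal_mulr.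
  have e2 := len_add (iY (k + n)%N) iC (@ideal_setT A) sC (fun _ _ => Logic.I) (fY _).
  have e3 : len (Y (k + n)%N) (Z n) = len (colone (Y (k + n)%N) x) setT.
    by rewrite len_mulI// setIT.
  have -> : len (Z n) setT = len (Y (k + n)%N) (colone (Y (k + n)%N) x).
    by move: e1; rewrite e2 e3 addnC => /addnI.
  have YY : Y (k + n)%N `<=` Y n.
    by apply: addI_monor => _ [c _ ->]; exists (y ^+ k * c); rewrite // addnC exprD mulrA.
  apply: (@leq_trans (len (Y (k + n)%N) (Y n))).
    by apply: len_mono (AR n) => //; apply: fin_sub (fY (k + n)%N).
  have -> : Y n = addI (Y (k + n)%N) (mulI (y ^+ n) setT).
    apply/seteqP; split; last by apply: addI_sub => //; exact: subIaddr.
    by apply: addI_mono => //; apply: subIaddl; exact: ideal_prin.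
  rewrite len_mulI// setIT; apply: len_mono => //.
  apply: addI_sub; first exact: ideal_colone.
    move=> z Hz; apply: subIaddl; [exact: ideal_prin|exact: ideal_mulr].
  move=> _ [c _ ->]; apply: subIaddr => //; exists c => //; rewrite exprD; ring.
have sZ n : Z n.+1 `<=` Z n.
  apply: addI_mono => //; apply: addI_monor => _ [c _ ->]; exists (y * c) => //.
  by rewrite addnS exprSr mulrA.
have fZ n : fin (Z n) setT by apply: fin_sub (fY (k + n)%N).
have [n Zn] : exists n, Z n.+1 = Z n.
  apply: contrapT => no.
  have grow n : (n <= len (Z n) setT)%N.
    elim: n => // n IH.
    rewrite (len_add (iZ n.+1) (iZ n) _ (sZ n) _ (fZ n.+1))//.
    suff : len (Z n.+1) (Z n) != 0%N by move: IH; lia.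
    apply/eqP => e0; apply: no; exists n.
    by apply: len_eq0 e0 => //; apply: fin_sub (fZ n.+1).
  by have := leq_trans (grow (len (Y k) setT).+1) (bound _); rewrite ltnn.
have Ry : R (y ^+ (k + n)).
  have : Z n.+1 (y ^+ (k + n)).
    by rewrite Zn; apply: YZ; apply: subIaddr => //; exact: prin_id.
  move=> [_ [_ [[h [_ [Hh [c _ ->] ->]]] [b _ ->] E]]].
  have [v vE] := @unit_1B _ _ noe loc (y * c) (ideal_mulr _ (ideal_m loc) my).
  apply: (@unit_cancel _ _ v _ _ iR vE); exists h, (x * b); split=> //; first by exists b.
  have -> : (1 - y * c) * y ^+ (k + n) = y ^+ (k + n) - y ^+ (k + n.+1) * c.
    by rewrite addnS exprS; ring.
  by rewrite {1}E; ring.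
apply: (sop_of noe loc ss) => z; rewrite inE => /orP[/eqP ->|zs].
- exists (k + n).+1; have [h [_ [Hh [b _ ->] E]]] := Ry.
  exists (x * (b * y)), (h * y); split; [by exists (b * y)|exact: Hh|].
  by rewrite exprSr E; ring.
- by apply: sub_radical; apply: mem_gen; rewrite inE zs orbT.
- exact: mx.
- by apply: sop_mem ss _; rewrite inE zs orbT.
Qed.

(** For w in m some w + y^(n+1) is a parameter modulo [gen s]. By [colone_indep] it multiplies the
    left colon ideal into [gen s], as y does, hence so does w. *)
Lemma colone_sop y s : size (y :: s) = d -> sop m (y :: s) ->
  colone (gen s) y = colon (gen s) m.
Proof.
move=> sd ss; have my : m y by apply: sop_mem ss _; rewrite mem_head.
apply/seteqP; split=> [u Hu w mw|u]; last by apply.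
have [n reg] := exists_regular_shift sd ss mw.
have mx : m (w + y ^+ n.+1).
  by apply: ideal_add (ideal_m loc) mw _; rewrite exprS; apply: ideal_mulr (ideal_m loc) _.
have sx := sop_of_regular sd ss mx reg.
have Nux : gen s (u * (w + y ^+ n.+1)) by exact: (@colone_indep y _ s sd ss sx).
have -> : u * w = u * (w + y ^+ n.+1) - (u * y) * y ^+ n by rewrite exprS; ring.
by apply: ideal_sub (ideal_gen s) Nux _; apply: ideal_mulr (ideal_gen s) _.
Qed.

(** Both w and x are parameters modulo N = [gen s]. From x v = w x u modulo N follows v - w u in N :
    x = N : w. So (N : w) + (w) contains m, and its colength is e(w, N). *)
Lemma mult_le1 w x s : size (w :: s) = d -> m w -> m x -> sop m (w * x :: s) ->
  (forall v, m v -> gen (w * x :: s) (x * v)) -> multiplicity d (gen (w :: s)) <= 1.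
Proof.
move=> sd mw mx ss h.
have sub u : m u -> (exists v, w * x = u * v) -> sop m (u :: s).
  move=> mu [v uv]; apply: (sop_of noe loc ss) => z; rewrite inE => /orP[/eqP ->|zs] //.
  - apply: sub_radical; rewrite uv; apply: ideal_mulr (ideal_gen _) _.
    by apply: mem_gen; rewrite mem_head.
  - by apply: sub_radical; apply: mem_gen; rewrite inE zs orbT.
  - by apply: sop_mem ss _; rewrite inE zs orbT.
have sw : sop m (w :: s) by apply: sub => //; exists x.
have sx : sop m (x :: s) by apply: sub => //; exists w; rewrite mulrC.
rewrite -(@len_colon 1 w s _ sd sw)// expr1 (ler_nat _ _ 1).
apply: leq_trans (len_residue noe loc).2; apply: len_mono => //.
  exact: (len_residue noe loc).1.
move=> v mv; have [_ [n [[u _ ->] Nn E]]] := h v mv.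
exists (v - w * u), (w * u); split; [|by exists u|by ring].
apply: (@colone_indep x w s sd sx sw); rewrite /colone /=.
have -> : (v - w * u) * x = x * v - w * x * u by ring.
by rewrite E addrC addKr.
Qed.

(** * Socles when e(A) > 1 *)

Hypothesis mult_gt1 : 1 < multiplicity d m.

Lemma mult_gen_gt1 s : size s = d -> sop m s -> 1 < multiplicity d (gen s).
Proof.
move=> sd ss; apply: lt_le_trans mult_gt1 _; apply: mult_m_le => //.
exact: lt_trans mult_gt1.
Qed.

(** A unit in Q : m would force m into Q = (y) + N, hence into (y) + (N : y), whose colength e(Q)
    would be at most 1. *)
Lemma colon_sub_m s : size s = d -> sop m s -> colon (gen s) m `<=` m.
Proof.
move=> sd ss x Ix; apply: contrapT => /(unit_notin noe loc)[v vx].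
have mQ : m `<=` gen s.
  by move=> w mw; apply: (unit_cancel (ideal_gen s) vx); exact: Ix.
have := mult_gen_gt1 sd ss; apply/negP; rewrite -leNgt.
case: s sd ss mQ {Ix} => [|y s] sd ss mQ; first by move: d_gt0; rewrite -sd.
rewrite -(@len_colon 1 y s _ sd ss)// expr1 (ler_nat _ _ 1).
apply: leq_trans (len_residue noe loc).2; apply: len_mono => //.
  exact: (len_residue noe loc).1.
apply: subset_trans mQ _; rewrite gen_cons; apply: addI_mono => // z.
exact: ideal_mulr (ideal_gen s).
Qed.

(* In the notation of ideals: m (Q : m) is contained in m Q. *)
Lemma mul_socle s x w : size s = d -> sop m s -> colon (gen s) m x -> m w ->
  exists2 c : nat -> A, (forall i, (i < size s)%N -> m (c i)) &
    w * x = \sum_(i < size s) c i * s`_i.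
Proof.
move=> sd ss Ix mw; have [c cE] : exists c : nat -> A, w * x = \sum_(i < size s) c i * s`_i.
  by apply: gen_lin; rewrite mulrC; exact: Ix.
(* A unit coefficient would let w x replace the i-th parameter among the generators of Q, which is
   the situation of [mult_le1]. *)
exists c => // i si; apply: contrapT => /(unit_notin noe loc)[v vc].
have [r Nr rE] := sum_omit c si; rewrite -cE in rE.
have wxQ : gen s (w * x) by rewrite mulrC; exact: Ix.
have iwx := ideal_gen (w * x :: omit i s).
have sub : gen s `<=` gen (w * x :: omit i s).
  rewrite (gen_omit si); apply: gen_sub => // z; rewrite inE => /orP[/eqP ->|zs].
    apply: (unit_cancel iwx vc).
    have -> : c i * s`_i = w * x - r by rewrite rE; ring.
    apply: ideal_sub => //; first by apply: mem_gen; rewrite mem_head.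
    by rewrite gen_cons; apply: subIaddl Nr; exact: ideal_prin.
  by apply: mem_gen; rewrite inE zs orbT.
have mx := colon_sub_m sd ss Ix.
have s' : sop m (w * x :: omit i s).
  apply: (sop_of noe loc ss) => z; first by move=> zs; apply: sub_radical; apply: sub; exact: mem_gen.
  rewrite inE => /orP[/eqP ->|zs]; first exact: ideal_mull (ideal_m loc) mx.
  by apply: sop_mem ss _; rewrite (mem_omit si) inE zs orbT.
have sd' : size (w :: omit i s) = d by rewrite /= size_omit.
have := mult_le1 sd' mw mx s' (fun v mv => sub _ (Ix v mv)).
apply/negP; rewrite -ltNge; apply: mult_gen_gt1 => //.
apply: (sop_of noe loc s') => z; rewrite inE => /orP[/eqP ->|zs] //.
- by apply: sub_radical; apply: ideal_mulr (ideal_gen _) _; apply: mem_gen; rewrite mem_head.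
- by apply: sub_radical; apply: mem_gen; rewrite inE zs orbT.
- by apply: sop_mem s' _; rewrite inE zs orbT.
Qed.

Lemma length_socle s : size s = d -> sop m s ->
  length (colon (gen s) m) (gen s) = ((len (gen s) (colon (gen s) m))%:R)%:E.
Proof.
move=> sd ss; apply: lengthE.
- by apply: ideal_colon; exact: ideal_gen.
- exact: ideal_gen.
- by move=> z sz w _; exact: ideal_mulr (ideal_gen s) sz.
- exact: fin_sub (fin_sop noe loc ss).
Qed.

Lemma length_le_cm_type s : size s = d -> sop m s ->
  (length (colon (gen s) m) (gen s) <= cm_type m d)%E.
Proof.
move=> sd ss; rewrite /cm_type; set S := [set _ | _ in _].
have Ss : S (length (colon (gen s) m) (gen s)).
  by exists (gen s) => //; exact: parameter_gen.
(* The lengths are finite and so lie in [enat]; their supremum exists, and [esup] does not take its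
   default value. *)
have [|[x xS] _] := @enat_supremums_neq0 S _ (ex_intro _ _ Ss).
  move=> _ [Q /parameter_list[t [td ts ->]] <-]; right.
  by rewrite length_socle//; eexists.
rewrite /esup /supremum; case: ifPn => [/eqP S0|_]; first by rewrite S0 in Ss.
case: xgetP => [y -> [uby _]|/(_ x)//]; exact: uby.
Qed.

(** With T = Q + H and Q2 = (y^2) + N, the quotient (T : m)/Q has the length of a submodule of (Q2 :
    m)/Q2. So l((T : m)/Q) <= r(A) = l((Q : m)/Q), while Q : m is contained in T : m. *)
Lemma socle_maximal_type y s : size (y :: s) = d -> sop m (y :: s) ->
  length (colon (gen (y :: s)) m) (gen (y :: s)) = cm_type m d ->
  colon (addI (gen (y :: s)) (colone (gen s) y)) m `<=` colon (gen (y :: s)) m.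
Proof.
move=> sd ss hlen.
pose N := gen s; pose Q := gen (y :: s); pose H := colone N y.
pose Q2 := gen (y ^+ 2 :: s).
have s2 : sop m (y ^+ 2 :: s) by exact: (sop_pow1 noe loc).
have iN : is_ideal N by exact: ideal_gen.
have iQ : is_ideal Q by exact: ideal_gen.
have iQ2 : is_ideal Q2 by exact: ideal_gen.
have iH : is_ideal H by exact: ideal_colone.
have fQ : fin Q setT by exact: fin_sop ss.
have fQ2 : fin Q2 setT by exact: fin_sop s2.
have NQ : N `<=` Q by rewrite /Q gen_cons; apply: subIaddl; exact: ideal_prin.
have NQ2 : N `<=` Q2 by rewrite /Q2 gen_cons; apply: subIaddl; exact: ideal_prin.
have NH : N `<=` H by move=> z; exact: ideal_mulr.
have Hy z : H (z * y) -> H z.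
  by move=> h; apply: (@colone_pow 2 y s sd ss); move: h; rewrite /H /colone /= expr2 mulrA.
have Q2Q : Q2 `<=` Q.
  rewrite /Q2 /Q !gen_cons; apply: addI_monor => _ [c _ ->].
  by exists (y * c); rewrite // expr2 mulrA.
(* If n + yb lies in H with n in N, then yb does too, so b lies in H because N : y^2 = N : y;
   therefore yb lies in N. *)
have QH : Q `&` H = N.
  apply/seteqP; split=> z; last by move=> Nz; split; auto.
  rewrite /Q gen_cons => -[[n [_ [Nn [b _ ->] zE]]] Hz].
  have Hyb : H (b * y).
    have -> : b * y = z - n by rewrite zE; ring.
    by apply: ideal_sub => //; exact: NH.
  by rewrite zE; apply: ideal_add => //; rewrite mulrC; exact: (Hy _ Hyb).
have Q2H : Q2 `&` H = N.
  apply/seteqP; split=> z; last by move=> Nz; split; auto.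
  by move=> [/Q2Q Qz Hz]; rewrite -QH.
pose T := addI Q H; have iT : is_ideal T by exact: ideal_addI.
pose J := addI Q2 H; have iJ : is_ideal J by exact: ideal_addI.
pose TM := colon T m; have iTM : is_ideal TM by exact: ideal_colon.
have TTM : T `<=` TM by move=> z Tz w _; exact: ideal_mulr.
have QT : Q `<=` T by exact: subIaddl.
have Ty z : T z -> Q2 (z * y).
  move=> [q [h [Qq Hh ->]]]; rewrite mulrDl; apply: ideal_add => //; last exact: NQ2.
  move: Qq; rewrite /Q gen_cons => -[n [_ [Nn [b _ ->] ->]]].
  rewrite mulrDl; apply: ideal_add => //; first by apply: NQ2; exact: ideal_mulr.
  rewrite /Q2 gen_cons; apply: subIaddr => //; exists b => //; rewrite expr2; ring.
have JT : colone J y `&` TM = T.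
  apply/seteqP; split=> z; last first.
    by move=> Tz; split; [apply: subIaddl => //; exact: Ty|exact: TTM].
  move=> [[q [h [Q2q Hh zE]]] _].
  move: Q2q zE; rewrite /Q2 gen_cons => -[n [_ [Nn [b _ ->] ->]]] zE.
  exists (y * b), (z - y * b); split; last by ring.
    by rewrite /Q gen_cons; apply: subIaddr => //; exists b.
  apply: Hy; have -> : (z - y * b) * y = n + h by rewrite mulrBl zE; ring.
  by apply: ideal_add => //; exact: NH.
pose I2 := colon Q2 m; have iI2 : is_ideal I2 by exact: ideal_colon.
have Q2I2 : Q2 `<=` I2 by move=> z Qz w _; exact: ideal_mulr.
pose K := addI J (mulI y TM); have iK : is_ideal K by apply: ideal_addI => //; exact: ideal_mulI.
have KI2 : K `<=` I2.
  apply: addI_sub => //.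
    apply: addI_sub => // z; rewrite /H (colone_sop sd ss) => Hz w mw.
    by apply: NQ2; exact: Hz.
  move=> _ [t TMt ->] w mw; have -> : y * t * w = t * w * y by ring.
  by apply: Ty; exact: TMt.
have JK : J `<=` K by apply: subIaddl; exact: ideal_mulI.
have Q2J : Q2 `<=` J by exact: subIaddl.
have fK : fin Q2 K by apply: fin_sub fQ2.
have lenTM : (len Q TM <= len Q2 I2)%N.
  (* Both T/Q and J/Q2 are isomorphic to H/N, and multiplication by y carries (T : m)/T
     isomorphically onto K/J; altogether this gives l(K/Q2). *)
  rewrite (len_add iQ iT iTM QT TTM (fin_sub _ _ fQ))// /T len_addI// QH -Q2H -len_addI//.
  rewrite -/T -JT -len_mulI// -/J -/K -(len_add iQ2 iJ iK Q2J JK fK).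
  by apply: len_mono => //; apply: fin_sub fQ2.
have le2 : (len Q2 I2 <= len Q (colon Q m))%N.
  have := length_le_cm_type (s := y ^+ 2 :: s) sd s2.
  by rewrite -hlen !length_socle// lee_fin ler_nat.
have iI : is_ideal (colon Q m) by exact: ideal_colon.
have QI : Q `<=` colon Q m by move=> z Qz w _; exact: ideal_mulr.
have ITM : colon Q m `<=` TM by move=> z Iz w mw; apply: QT; exact: Iz.
have e := len_add iQ iI iTM QI ITM (fin_sub (fun _ => id) (fun _ _ => Logic.I) fQ).
have l0 : len (colon Q m) TM = 0%N by apply/eqP; move: (leq_trans lenTM le2); rewrite e -[leqRHS]addn0 leq_add2l leqn0.
have fI : fin (colon Q m) TM by apply: fin_sub fQ.
by rewrite -/Q -/N -/H -/T -/TM (len_eq0 iTM ITM fI l0).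
Qed.

Lemma socle_mul_mem s x y : size s = d -> sop m s ->
  length (colon (gen s) m) (gen s) = cm_type m d ->
  colon (gen s) m x -> colon (gen s) m y -> ideal_mul (gen s) (colon (gen s) m) (x * y).
Proof.
move=> sd ss hlen Ix Iy.
have [z zE] := gen_lin (Ix y (colon_sub_m sd ss Iy)).
rewrite zE; apply: ideal_sum (ideal_span_ideal _) _ => i _.
apply: sub_ideal_span; exists s`_i, (z i); split; [by apply: mem_gen; exact: mem_nth| |exact: mulrC].
have si := ltn_ord i; pose s' := omit i s.
have sd' : size (s`_i :: s') = d by rewrite /= size_omit.
have ss' : sop m (s`_i :: s') by apply: sop_eqi ss _; exact: mem_omit.
have QE := gen_omit si; rewrite QE in hlen |- *.
apply: (socle_maximal_type sd' ss' hlen) => w mw.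
have [c mc cE] := mul_socle sd ss Ix mw.
(* The product w x y is expanded in two ways: through x y with coefficients w z_j, and through w x
   with coefficients c_j y, which lie in Q because c_j is in m. *)
have rel : \sum_(j < size s) (w * z j - c j * y) * s`_j = 0.
  transitivity (w * (\sum_(j < size s) z j * s`_j) - (\sum_(j < size s) c j * s`_j) * y).
    by rewrite mulr_sumr mulr_suml -sumrB; apply: eq_bigr => j _; ring.
  by rewrite -zE -cE; ring.
have [r Nr rE] := sum_omit (fun j => w * z j - c j * y) si; rewrite rel in rE.
exists (c i * y), (w * z i - c i * y); split; last by ring.
  by rewrite -QE mulrC; apply: Iy; exact: mc.
rewrite /colone /=; have -> : (w * z i - c i * y) * s`_i = - r.
  by apply/eqP; rewrite -addr_eq0 -rE.
exact: ideal_opp (ideal_gen _) Nr.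
Qed.

End Buchsbaum.

End BuchsbaumRings.

(** * The equality of I^2 and QI *)

Theorem mainTheorem6 (A : comNzRingType) (m : set A) (d : nat)
    (hA : buchsbaum m d) (he : 1 < multiplicity d m)
    (Q : set A) (hQ : parameter_ideal m d Q) :
  let I := colon Q m in
  length I Q = cm_type m d -> ideal_exp I 2 = ideal_mul Q I.
Proof.
case: hA => noe loc _ d_gt0 buch I hlen.
have [s [sd ss QE]] := parameter_list hQ.
have iQ : is_ideal Q by rewrite QE; exact: ideal_gen.
have iI : is_ideal I by exact: ideal_colon.
have QI : subset Q I by move=> z Qz w _; exact: ideal_mulr.
pose C := (len (gen s) setT)%:R - multiplicity d (gen s).
have hC t : size t = d -> sop m t -> (len (gen t) setT)%:R = multiplicity d (gen t) + C.
  move=> td ts; have := buch _ _ (parameter_gen td ts) (parameter_gen sd ss).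
  rewrite !lengthE //; try exact: ideal_gen; try exact: fin_sop ts; try exact: fin_sop ss.
  by move=> [E]; rewrite /C -E addrCA subrr addr0.
(* [ideal_exp I 2] unfolds to I (I A), so factors in I have to be matched with elements of
   [ideal_mul I setT]. *)
have mulI1 z : I z -> ideal_mul I setT z.
  by move=> Iz; apply: sub_ideal_span; exists z, 1; rewrite mulr1.
apply/seteqP; split; apply: ideal_span_sub; try exact: ideal_span_ideal.
  move=> _ [x [y [Ix Iy ->]]].
  have {}Iy : I y.
    by apply: (ideal_span_sub iI) Iy => _ [u [v [Iu _ ->]]]; exact: (ideal_mulr v iI Iu).
  rewrite /I QE; apply: (socle_mul_mem noe loc d_gt0 hC he sd ss); rewrite -QE //.
move=> _ [x [y [Qx Iy ->]]]; apply: sub_ideal_span; exists x, y.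
by split; [exact: QI|exact: mulI1|].
Qed.
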